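(* Let $\pi\in\mathcal M_+^1(\Theta)$ be a prior distribution, let $\epsilon\in(0,1)$ and let $\nu\in\mathcal M_+^1(\mathbb R_+)$ be an atomic probability distribution on the positive real line. With $\mathbb P$ probability at least $1-\epsilon$, for any posterior distribution $\rho:\Omega\to\mathcal M_+^1(\Theta)$ and any positive real constants $\beta$ and $\gamma$, $$\bigl[N\tanh(\tfrac{\gamma}{N})-\beta\bigr]\bigl[\rho(R)-\pi_{\exp(-\beta R)}(R)\bigr]\le F_{\gamma,\beta}\bigl[\rho(R)-\pi_{\exp(-\beta R)}(R)\bigr]\le B(\rho,\beta,\gamma),$$ where, the infimum being taken over all $\lambda_1\in\mathbb R_+$ with $\lambda_1\le\gamma$ and all $\lambda_2\in\mathbb R$ with $\lambda_2>\frac{\beta\gamma}{N}\tanh(\frac{\gamma}{N})^{-1}$, $$\begin{aligned}B(\rho,\beta,\gamma)=\inf_{\lambda_1,\lambda_2}\Bigl\{&\mathcal K\bigl[\rho,\pi_{\exp(-\lambda_1 r)}\bigr]+(\gamma-\lambda_1)\bigl[\rho(r)-\pi_{\exp(-\lambda_2 r)}(r)\bigr]\\&+\log\Bigl\{\pi_{\exp(-\lambda_1 r)}\Bigl[\exp\bigl\{N\log[\cosh(\tfrac{\gamma}{N})]\,\rho(m')\bigr\}\Bigr]\Bigr\}-\log\bigl[\epsilon\,\nu(\beta)\nu(\gamma)\bigr]\\&+(\gamma-\lambda_1)\tfrac{\beta}{\lambda_2}F^{-1}_{\gamma,\frac{\beta\gamma}{\lambda_2}}\Bigl[\log\Bigl\{\pi_{\exp(-\lambda_2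 r)}\Bigl[\exp\bigl\{N\log[\cosh(\tfrac{\gamma}{N})]\,\pi_{\exp(-\lambda_2 r)}(m')\bigr\}\Bigr]\Bigr\}-\log\bigl[\epsilon\,\nu(\beta)\nu(\gamma)\bigr]\Bigr]\Bigr\}.\end{aligned}$$ Moreover, with the infimum over the same set of $(\lambda_1,\lambda_2)$, $$\begin{aligned}B(\rho,\beta,\gamma)\le\inf_{\lambda_1,\lambda_2}\Bigl\{&\mathcal K\bigl[\rho,\pi_{\exp(-\lambda_1 r)}\bigr]+(\gamma-\lambda_1)\bigl[\rho(r)-\pi_{\exp(-\lambda_2 r)}(r)\bigr]\\&+\log\Bigl\{\pi_{\exp(-\lambda_1 r)}\Bigl[\exp\bigl\{N\log[\cosh(\tfrac{\gamma}{N})]\,\rho(m')\bigr\}\Bigr]\Bigr\}\\&+\frac{\beta}{\lambda_2}\,\frac{1-\frac{\lambda_1}{\gamma}}{\frac{N}{\gamma}\tanh(\frac{\gamma}{N})-\frac{\beta}{\lambda_2}}\log\Bigl\{\pi_{\exp(-\lambda_2 r)}\Bigl[\exp\bigl\{N\log[\cosh(\tfrac{\gamma}{N})]\,\pi_{\exp(-\lambda_2 r)}(m')\bigr\}\Bigr]\Bigr\}\\&-\Bigl\{1+\frac{\beta}{\lambda_2}\,\frac{1-\frac{\lambda_1}{\gamma}}{\frac{N}{\gamma}\tanh(\frac{\gamma}{N})-\frac{\beta}{\lambda_2}}\Bigr\}\log\bigl[\epsilon\,\nu(\beta)\nu(\gamma)\bigr]\Bigr\}.\end{aligned}$$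
   Context: Setting. $N\ge 1$ is an integer, $(\mathcal X,\mathcal B)$ a measurable space, $\mathcal Y$ a finite set with the algebra of all its subsets, $\Omega=(\mathcal X\times\mathcal Y)^N$ with coordinate process $(X_i,Y_i)_{i=1}^N$, and $\mathbb P=\bigotimes_{i=1}^N P_i$ a product of arbitrary (not necessarily identical) probability measures on $\mathcal X\times\mathcal Y$. $(\Theta,\mathcal T)$ is a measurable space and $(\theta,x)\mapsto f_\theta(x)\in\mathcal Y$ is measurable on $\Theta\times\mathcal X$. All $\sigma$-algebras are countably generated. Put $$r(\theta)=\frac1N\sum_{i=1}^N\mathbf 1[f_\theta(X_i)\ne Y_i],\qquad R(\theta)=\frac1N\sum_{i=1}^N\mathbb P[f_\theta(X_i)\ne Y_i],$$ $$m'(\theta,\theta')=\frac1N\sum_{i=1}^N\bigl|\mathbf 1[f_\theta(X_i)\ne Y_i]-\mathbf 1[f_{\theta'}(X_i)\ne Y_i]\bigr|.$$ $\mathcal M_+^1(E)$ is the set of probability measures on $E$; for a measure $\mu$, $\mu(h)=\int h\,d\mu$; for a probability measure $\rho$ on $\Theta$, $\rho(m')$ denotes the function $\theta'\mapsto\int m'(\theta,\theta')\rho(d\theta)$. A posterior distribution is a regular conditional probability measure $\rho:\Omega\to\mathcal M_+^1(\Theta)$ (it may depend on the sample); a prior does not depend on the sample. $\mathcal K(\rho,\pi)=\int\log(d\rho/d\pi)\,d\rho$ if $\rho\ll\pi$, $+\infty$ otherwise. For bounded measurable $h$, $\pi_{\exp(h)}$ is defined by $d\pi_{\exp(h)}/d\pi=\exp(h)/\pi[\exp(h)]$.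 For real $\alpha$ and $\gamma>0$, $F_{\gamma,\alpha}(x)=-N\log[1-\tanh(\tfrac\gamma N)x]-\alpha x$ (a convex function); when $\alpha<N\tanh(\gamma/N)$ and $y\ge0$, $F_{\gamma,\alpha}^{-1}(y)$ is the unique $x\in[0,\tanh(\gamma/N)^{-1})$ with $F_{\gamma,\alpha}(x)=y$. $\nu(\beta)$ stands for $\nu(\{\beta\})$; $B(\rho,\beta,\gamma)=+\infty$ when $\nu(\beta)=0$ or $\nu(\gamma)=0$. ''With probability at least $1-\epsilon$, for any ...'' means that on an event of probability at least $1-\epsilon$ the inequalities hold simultaneously for all the listed objects. *)

(* Defs.v *)
From HB Require Import structures.
From mathcomp Require Import all_boot all_order all_algebra.
From mathcomp Require Import all_classical all_reals all_analysis.
From mathcomp Require Import measurable_realfun.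

Set Implicit Arguments.
Unset Strict Implicit.
Unset Printing Implicit Defensive.

Import Order.TTheory GRing.Theory Num.Theory.
Import numFieldNormedType.Exports.

Local Open Scope classical_set_scope.
Local Open Scope ring_scope.

Definition countably_generated d (T : measurableType d) : Prop :=
  exists2 G : set (set T), countable G & @measurable d T = <<s G >>.

Section hyperbolic.
Context {R : realType}.

Definition cosh (x : R) : R := (expR x + expR (- x)) / 2.

Definition tanh (x : R) : R :=
  (expR x - expR (- x)) / (expR x + expR (- x)).

End hyperbolic.

Section product_measure_tuple.
Context d (T : measurableType d) (R : realType).

Definition tuple_cons n (p : T * n.-tuple T) : n.+1.-tuple T :=
  [tuple of p.1 :: p.2].

Let measurable_tuple_cons n : measurable_fun [set: T * n.-tuple T] (@tuple_cons n).
Proof. exact: measurable_cons. Qed.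

HB.instance Definition _ n :=
  isMeasurableFun.Build _ _ _ _ (@tuple_cons n) (@measurable_tuple_cons n).

(* The product [\bigotimes_(i < n) P i] on [n.-tuple T], by recursion on [n];
   its characteristic property is [product_probabilityE]. *)
Fixpoint product_probability n :
    ('I_n -> probability T R) -> probability (n.-tuple T) R :=
  match n with
  | 0 => fun=> \d_[tuple]
  | m.+1 => fun P => distribution
      (P ord0 \x product_probability (fun i => P (lift ord0 i)))%E (@tuple_cons m)
  end.

Lemma product_probabilityE n (P : 'I_n -> probability T R)
    (A : 'I_n -> set T) : (forall i, measurable (A i)) ->
  product_probability P [set w | forall i, A i (tnth w i)] =
  (\prod_(i < n) P i (A i))%E.
Proof.
elim: n P A => [|n IHn] P A mA.
  by rewrite big_ord0 /= diracE mem_set// => -[].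
rewrite big_ord_recl -IHn//= /distribution /pushforward.
set B := [set w : n.-tuple T | forall i, A (lift ord0 i) (tnth w i)].
rewrite (_ : _ @^-1` _ = A ord0 `*` B); last first.
  apply/seteqP; split => [[x w] /= H|[x w] /= [H0 H] i].
    split; first by have := H ord0; rewrite tnth0.
    by move=> i; have := H (lift ord0 i); rewrite /tuple_cons tnthS.
  have [j ->|->] := unliftP ord0 i; first by rewrite /tuple_cons tnthS; exact: H.
  by rewrite /tuple_cons tnth0.
have mB : measurable B.
  rewrite (_ : B = \big[setI/setT]_(i < n)
      ((@tnth n T ^~ i) @^-1` A (lift ord0 i))).
    apply: bigsetI_measurable => i _; rewrite -[X in measurable X]setTI.
    exact: measurable_tnth.
  rewrite -bigcap_seq; apply/seteqP; split => [w Hw i _|w Hw i] /=.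
    exact: Hw.
  by apply: Hw; rewrite /= mem_index_enum.
by rewrite product_measure1E.
Qed.

End product_measure_tuple.

Section gibbs.
Context d (T : measurableType d) (R : realType).

Section density.
Variables (mu : {measure set T -> \bar R}) (h : {mfun T >-> R}).

Definition exp_density (A : set T) : \bar R := (\int[mu]_(x in A) (expR (h x))%:E)%E.

Let mexp : measurable_fun setT (EFin \o (expR \o h)).
Proof. by apply/measurable_EFinP; exact: measurableT_comp. Qed.

Let exp_density0 : exp_density set0 = 0%E.
Proof. exact: integral_set0. Qed.

Let exp_density_ge0 A : (0 <= exp_density A)%E.
Proof. by apply: integral_ge0 => x _; rewrite lee_fin expR_ge0. Qed.

Let exp_density_sigma_additive : semi_sigma_additive exp_density.
Proof.
by apply: semi_sigma_additive_nng_induced => // x; rewrite lee_fin expR_ge0.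
Qed.

HB.instance Definition _ := isMeasure.Build _ _ _ exp_density
  exp_density0 exp_density_ge0 exp_density_sigma_additive.

End density.

(* [gibbs pi h] is $\pi_{\exp(h)}$, see [gibbsE]; when [h] is not measurable or
   [expR \o h] is not [pi]-integrable, it is [pi] by convention. *)
Definition gibbs (pi : probability T R) (h : T -> R) : probability T R :=
  match pselect (measurable_fun setT h) with
  | left mh => mnormalize (exp_density pi (mfun_Sub (mem_set mh))) pi
  | right _ => pi
  end.

Lemma gibbsE (pi : probability T R) (h : T -> R) (M : R) (A : set T) :
  measurable_fun setT h -> (forall x, `|h x| <= M) -> measurable A ->
  gibbs pi h A =
  (\int[pi]_(x in A) (expR (h x) / \int[pi]_y expR (h y))%:E)%E.
Proof.
move=> mh hM mA; rewrite /gibbs; case: pselect => // mh'.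
have mexp : measurable_fun setT (expR \o h) by exact: measurableT_comp.
have iexp : pi.-integrable setT (EFin \o (expR \o h)).
  apply: (@le_integrable _ _ _ pi _ measurableT _ (EFin \o cst (expR M))) => //.
  - exact/measurable_EFinP.
  - move=> x _ /=; rewrite lee_fin !ger0_norm ?expR_ge0// ler_expR.
    by rewrite (le_trans (ler_norm _)).
  - exact: finite_measure_integrable_cst.
have fexp := integrable_fin_num measurableT iexp.
have exp_gt0 : (0 < \int[pi]_x (expR (h x))%:E)%E.
  apply: (@lt_le_trans _ _ (\int[pi]_x (expR (- M))%:E)%E).
    rewrite (@integral_cst _ _ _ pi _ measurableT (expR (- M))%:E).
    by rewrite [X in (_ * X)%E](probability_setT pi) mule1 lte_fin expR_gt0.
  apply: ge0_le_integral => //.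
  - exact/measurable_EFinP.
  - move=> x _; rewrite lee_fin ler_expR.
    by have := hM x; rewrite ler_norml => /andP[].
rewrite /= /mnormalize /= ifF; last first.
  apply/negbTE; rewrite negb_or gt_eqF//=.
  by move: fexp; rewrite fin_numE => /andP[].
under [RHS]eq_integral do rewrite EFinM.
rewrite ge0_integralZr//.
- exact/measurable_funTS/measurable_EFinP.
- by rewrite lee_fin invr_ge0 fine_ge0// ltW.
Qed.

End gibbs.

(* $\mathcal K(\rho,\pi)$. The Radon-Nikodym derivative is only specified almost
   everywhere and [lne], the logarithm on [\bar R], is [-oo] on nonpositive
   values; these form a [rho]-null set. *)
Definition KL d (T : measurableType d) (R : realType)
    (rho mu : probability T R) : \bar R :=
  if `[< rho `<< mu >] then
    (\int[rho]_x lne (Radon_Nikodym (charge_of_finite_measure rho) mu x))%E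
  else +oo%E.

Definition atomic d (T : measurableType d) (R : realType)
    (mu : probability T R) : Prop :=
  exists S : set T, [/\ countable S, measurable S & mu S = 1%E].

Section deviation_function.
Context {R : realType} (N : nat).

Definition F (gamma alpha x : R) : R :=
  - N%:R * ln (1 - tanh (gamma / N%:R) * x) - alpha * x.

(* [xget 0 A] is an element of [A] when there is one (here there is at most
   one, for [alpha < N * tanh (gamma / N)]) and [0] otherwise. *)
Definition F_inv (gamma alpha y : R) : R :=
  xget 0 [set x | 0 <= x < (tanh (gamma / N%:R))^-1 /\ F gamma alpha x = y].

End deviation_function.

Section relative_bound.
Context {R : realType} {N : nat} {dX dY dT : measure_display}
  {X : measurableType dX} {Y : measurableType dY} {Theta : measurableType dT}.
Variables (P : 'I_N -> probability (X * Y)%type R) (f : Theta -> X -> Y).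

Local Notation Omega := (N.-tuple (X * Y)%type).
Implicit Types (w : Omega) (theta : Theta) (rho : probability Theta R).

Definition err theta (z : X * Y) : R := (f theta z.1 != z.2)%:R.

Definition emp_risk w theta : R :=
  N%:R^-1 * \sum_(i < N) err theta (tnth w i).

Definition risk theta : R :=
  N%:R^-1 * \sum_(i < N) fine (product_probability P
    [set w : Omega | f theta (tnth w i).1 != (tnth w i).2]).

(* $m'$ *)
Definition emp_dist w theta theta' : R :=
  N%:R^-1 *
  \sum_(i < N) `|err theta (tnth w i) - err theta' (tnth w i)|.

Variables (prior : probability Theta R) (eps : R)
  (nu : probability (measurableTypeR R) R).

(* $\pi_{\exp(-\lambda r)}$ *)
Definition gibbs_emp w (lambda : R) : probability Theta R :=
  gibbs prior (fun theta => - lambda * emp_risk w theta).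

(* $\pi_{\exp(-\beta R)}$ *)
Definition gibbs_risk (beta : R) : probability Theta R :=
  gibbs prior (fun theta => - beta * risk theta).

(* $\rho(R)-\pi_{\exp(-\beta R)}(R)$ *)
Definition excess_risk rho (beta : R) : R :=
  \int[rho]_theta risk theta - \int[gibbs_risk beta]_theta risk theta.

(* $\log\{\pi_{\exp(-\lambda r)}[\exp\{N\log[\cosh(\gamma/N)]\,\rho(m')\}]\}$ *)
Definition log_exp_dist w (gamma lambda : R) rho : R :=
  ln (\int[gibbs_emp w lambda]_theta'
        expR (N%:R * ln (cosh (gamma / N%:R)) *
              \int[rho]_theta emp_dist w theta theta')).

(* $\log[\epsilon\,\nu(\beta)\nu(\gamma)]$ *)
Definition log_level (beta gamma : R) : R :=
  ln (eps * fine (nu [set beta]) * fine (nu [set gamma])).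

(* [ln 0 = 0] in the library: the first case restores the convention
   $-\log 0=+\infty$. *)
Definition inf_bound (beta gamma : R) (term : R -> R -> \bar R) : \bar R :=
  if (nu [set beta] == 0%E) || (nu [set gamma] == 0%E) then +oo%E
  else ereal_inf [set term lambda1 lambda2 |
    lambda1 in [set l : R | 0 <= l <= gamma] &
    lambda2 in [set l : R |
      beta * gamma / N%:R * (tanh (gamma / N%:R))^-1 < l]].

Definition B w rho (beta gamma : R) : \bar R :=
  inf_bound beta gamma (fun lambda1 lambda2 =>
    (KL rho (gibbs_emp w lambda1) +
    ((gamma - lambda1) * (\int[rho]_theta emp_risk w theta -
       \int[gibbs_emp w lambda2]_theta emp_risk w theta)
     + log_exp_dist w gamma lambda1 rho
     - log_level beta gamma
     + (gamma - lambda1) * (beta / lambda2) *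
       F_inv N gamma (beta * gamma / lambda2)
         (log_exp_dist w gamma lambda2 (gibbs_emp w lambda2)
          - log_level beta gamma))%R%:E)%E).

Definition B_explicit w rho (beta gamma : R) : \bar R :=
  inf_bound beta gamma (fun lambda1 lambda2 =>
    let c := beta / lambda2 * ((1 - lambda1 / gamma) /
      (N%:R / gamma * tanh (gamma / N%:R) - beta / lambda2)) in
    (KL rho (gibbs_emp w lambda1) +
    ((gamma - lambda1) * (\int[rho]_theta emp_risk w theta -
       \int[gibbs_emp w lambda2]_theta emp_risk w theta)
     + log_exp_dist w gamma lambda1 rho
     + c * log_exp_dist w gamma lambda2 (gibbs_emp w lambda2)
     - (1 + c) * log_level beta gamma)%R%:E)%E).

End relative_bound.

(* Main.v *)
Require Import Defs.
From HB Require Import structures.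
From mathcomp Require Import all_boot all_order all_algebra.
From mathcomp Require Import all_classical all_reals all_analysis.
From mathcomp Require Import measurable_realfun.
From mathcomp Require Import ring lra.
Import Order.TTheory GRing.Theory Num.Theory.
Import numFieldNormedType.Exports.
Local Open Scope classical_set_scope.
Local Open Scope ring_scope.

(** For two classifiers theta and theta', the losses on the i-th example differ
    by psi_i in {-1, 0, 1}, and on these three values, with a = gamma / N,
      exp (- a psi - log (cosh a) |psi|) = 1 - tanh a * psi.
    By independence and the inequality of arithmetic and geometric means, the
    expectation of
      exp (G (R theta - R theta') - gamma (r theta - r theta')
           - N log (cosh a) m' (theta, theta')),
    with G = F gamma 0, is therefore at most 1 ([expected_deviation]). It is
    integrated over theta and theta' both drawn from mu = pi_exp(-beta R), which
    does not depend on the sample. Markov's inequality and a union bound over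
    the atoms of nu give the event on which everything else is deterministic
    ([likely_deviation_event]).

    On that event, Jensen's inequality in theta' and the Donsker-Varadhan
    inequality in theta bound F gamma beta (rho R - mu R) for every posterior
    rho ([posterior_bound]). Since mu is a Gibbs measure, entropies with respect
    to mu, pi and pi_exp(-lambda r) differ only by integrals of R and r and by
    log-partition functions. What remains unobservable in the bound is mu (r)
    and rho (x) mu (m').

    Write rho2 for pi_exp(-lambda2 r), L2 for
    log rho2 [exp (N log (cosh a) rho2 (m'))], F^-1 for the value of the inverse
    deviation function in the bound, d for rho2 (r) - mu (r) and
    xi = (lambda2 / beta) d. Comparing the two Gibbs measures gives
    xi <= rho2 (R) - mu (R) ([gibbs_order]). The case d <= 0 is trivial.
    There are two ways to finish ([relative_bound]).
    - If d <= (beta / lambda2) F^-1, then mu (r) is replaced by rho2 (r) at that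
      cost, and the variational formula for pi_exp(-lambda1 r), tested at mu,
      absorbs the distance term.
    - If L2 <= (lambda2 - gamma) d, the same formula is tested at rho2 instead,
      and the distance term follows from the triangle inequality for m'.
    One of the two always holds. By convexity, F gamma beta at xi is bounded
    either by its value at rho2 (R) - mu (R), and then the bound for the
    posterior rho2 gives the first alternative, or by its value 0 at 0, that is,
    G xi <= beta xi = lambda2 d. In that case, either
    lambda2 d <= gamma d + L2 - log (eps nu(beta) nu(gamma)),
    which is again the first alternative, or the second one holds. As L2 >= 0
    and d > 0, the second alternative only concerns lambda2 >= gamma.

    The explicit bound follows from F >= (N tanh a - alpha) x, which makes
    F^-1 at most linear ([F_inv_le]). *)

Set Implicit Arguments.
Unset Strict Implicit.
Unset Printing Implicit Defensive.

(** * Integrals of bounded measurable functions *)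

Section bounded_measurable.
Context d (T : measurableType d) (R : realType).
Implicit Types (h g : T -> R) (Q : probability T R).

Definition bounded_measurable h :=
  measurable_fun setT h /\ exists M, forall x, `|h x| <= M.

Local Notation bm := bounded_measurable.

Lemma bm_cst (c : R) : bm (fun=> c).
Proof. by split; [exact: measurable_cst | exists `|c|]. Qed.

Lemma bmD h g : bm h -> bm g -> bm (fun x => h x + g x).
Proof.
move=> [mh [M hM]] [mg [L gL]]; split; first exact: measurable_funD.
by exists (M + L) => x; rewrite (le_trans (ler_normD _ _))// lerD.
Qed.

Lemma bmM h g : bm h -> bm g -> bm (fun x => h x * g x).
Proof.
move=> [mh [M hM]] [mg [L gL]]; split; first exact: measurable_funM.
by exists (M * L) => x; rewrite normrM ler_pM.
Qed.

Lemma bmZ (c : R) h : bm h -> bm (fun x => c * h x).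
Proof. by move=> ?; apply: bmM => //; exact: bm_cst. Qed.

Lemma bmN h : bm h -> bm (fun x => - h x).
Proof. by move=> /(bmZ (-1)); under eq_fun do rewrite mulN1r. Qed.

Lemma bmB h g : bm h -> bm g -> bm (fun x => h x - g x).
Proof. by move=> ? ?; apply: bmD => //; exact: bmN. Qed.

Lemma bm_expR h : bm h -> bm (fun x => expR (h x)).
Proof.
move=> [mh [M hM]]; split; first exact: measurableT_comp.
exists (expR M) => x; rewrite ger0_norm ?expR_ge0// ler_expR.
exact: le_trans (ler_norm _) (hM x).
Qed.

Lemma bm_sum I (s : seq I) (h : I -> T -> R) : (forall i, bm (h i)) ->
  bm (fun x => \sum_(i <- s) h i x).
Proof.
move=> bh; elim: s => [|i s IHs].
  by under eq_fun do rewrite big_nil; exact: bm_cst.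
by under eq_fun do rewrite big_cons; exact: bmD.
Qed.

Lemma bm_prod I (s : seq I) (h : I -> T -> R) : (forall i, bm (h i)) ->
  bm (fun x => \prod_(i <- s) h i x).
Proof.
move=> bh; elim: s => [|i s IHs].
  by under eq_fun do rewrite big_nil; exact: bm_cst.
by under eq_fun do rewrite big_cons; exact: bmM.
Qed.

Lemma bm_norm h : bm h -> bm (fun x => `|h x|).
Proof.
move=> [mh [M hM]]; split; first exact: measurableT_comp.
by exists M => x; rewrite normr_id.
Qed.

Lemma bm_integrable Q h : bm h -> Q.-integrable setT (EFin \o h).
Proof.
move=> [mh [M hM]].
apply: (@le_integrable _ _ _ Q _ measurableT _ (EFin \o cst M)) => //.
- exact/measurable_EFinP.
- by move=> x _ /=; rewrite lee_fin (le_trans (hM x))// ler_norm.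
- exact: finite_measure_integrable_cst.
Qed.

Lemma bm_EFin_Rintegral Q h : bm h ->
  (\int[Q]_x h x)%:E = (\int[Q]_x (h x)%:E)%E.
Proof.
by move=> bh; rewrite /Rintegral fineK//; apply: integrable_fin_num => //;
  exact: bm_integrable.
Qed.

Lemma Rintegral_prob_cst Q (c : R) : \int[Q]_x c = c.
Proof. by rewrite Rintegral_cst//= probability_setT mulr1. Qed.

Lemma bm_RintegralD Q h g : bm h -> bm g ->
  \int[Q]_x (h x + g x) = \int[Q]_x h x + \int[Q]_x g x.
Proof. by move=> bh bg; rewrite RintegralD//; exact: bm_integrable. Qed.

Lemma bm_RintegralB Q h g : bm h -> bm g ->
  \int[Q]_x (h x - g x) = \int[Q]_x h x - \int[Q]_x g x.
Proof. by move=> bh bg; rewrite RintegralB//; exact: bm_integrable. Qed.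

Lemma bm_RintegralZ Q (c : R) h : bm h ->
  \int[Q]_x (c * h x) = c * \int[Q]_x h x.
Proof. by move=> bh; rewrite RintegralZl//; exact: bm_integrable. Qed.

Lemma bm_le_Rintegral Q h g : bm h -> bm g -> (forall x, h x <= g x) ->
  \int[Q]_x h x <= \int[Q]_x g x.
Proof. by move=> bh bg hg; apply: le_Rintegral => //; exact: bm_integrable. Qed.

Lemma bm_Rintegral_le Q h (c : R) : bm h -> (forall x, h x <= c) ->
  \int[Q]_x h x <= c.
Proof.
move=> bh hc; rewrite -[leRHS](Rintegral_prob_cst Q).
by apply: bm_le_Rintegral => //; exact: bm_cst.
Qed.

Lemma bm_Rintegral_ge Q h (c : R) : bm h -> (forall x, c <= h x) ->
  c <= \int[Q]_x h x.
Proof.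
move=> bh hc; rewrite -[leLHS](Rintegral_prob_cst Q).
by apply: bm_le_Rintegral => //; exact: bm_cst.
Qed.

Lemma Rintegral_expR_gt0 Q h : bm h -> 0 < \int[Q]_x expR (h x).
Proof.
move=> bh; have [_ [M hM]] := bh.
apply: (@lt_le_trans _ _ (expR (- M))); first exact: expR_gt0.
apply: bm_Rintegral_ge; first exact: bm_expR.
by move=> x; rewrite ler_expR; have := hM x; rewrite ler_norml => /andP[].
Qed.

(** Integrate the tangent inequality of the exponential at the mean of h. *)
Lemma expR_Jensen Q h : bm h -> expR (\int[Q]_x h x) <= \int[Q]_x expR (h x).
Proof.
move=> bh; set c := \int[Q]_x h x.
have be := bm_expR bh.
have -> : expR c = \int[Q]_x (expR c * (1 + (h x - c))).
  have bb : bm (fun x => h x - c) by apply: bmB => //; exact: bm_cst.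
  rewrite bm_RintegralZ; last by apply: bmD => //; exact: bm_cst.
  rewrite bm_RintegralD//; last exact: bm_cst.
  rewrite bm_RintegralB//; last exact: bm_cst.
  by rewrite !Rintegral_prob_cst subrr addr0 mulr1.
apply: bm_le_Rintegral => //.
  apply: bmZ; apply: bmD; first exact: bm_cst.
  by apply: bmB => //; exact: bm_cst.
move=> x; have -> : expR (h x) = expR c * expR (h x - c).
  by rewrite -expRD addrC subrK.
by rewrite ler_wpM2l ?expR_ge0// expR_ge1Dx.
Qed.

End bounded_measurable.

Lemma bm_comp d d' (T : measurableType d) (T' : measurableType d')
    (R : realType) (h : T' -> R) (g : T -> T') :
  bounded_measurable h -> measurable_fun setT g ->
  bounded_measurable (fun x => h (g x)).
Proof.
move=> [mh [M hM]] mg; split; first exact: (measurableT_comp mh mg).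
by exists M => x; exact: hM.
Qed.

(** * Gibbs measures and the entropy variational formula *)

Section gibbs_variational.
Context d (T : measurableType d) (R : realType).
Implicit Types (h g k : T -> R) (Q pi rho : probability T R).

Local Notation bm := (@bounded_measurable _ T R).

Definition log_partition pi h : R := ln (\int[pi]_x expR (h x)).

Lemma expR_log_partition pi h : bm h ->
  expR (log_partition pi h) = \int[pi]_x expR (h x).
Proof. by move=> bh; rewrite lnK// posrE Rintegral_expR_gt0. Qed.

Lemma gibbs_density pi h (A : set T) : bm h -> measurable A ->
  gibbs pi h A = (\int[pi]_(x in A) (expR (h x - log_partition pi h))%:E)%E.
Proof.
move=> bh mA; have [mh [M hM]] := bh.
rewrite (gibbsE pi mh hM mA); apply: eq_integral => x _.
by rewrite expRB expR_log_partition.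
Qed.

(** [p] is a version of the Radon-Nikodym derivative of [Q], so this is a change
    of variables. *)
Lemma Rintegral_density pi Q (p : T -> R) g : bm p -> bm g ->
  (forall A, measurable A -> Q A = (\int[pi]_(x in A) (p x)%:E)%E) ->
  \int[Q]_x g x = \int[pi]_x (g x * p x).
Proof.
move=> bp bg Qp; have [mp _] := bp.
have Qpi : Q `<< pi.
  apply/null_content_dominatesP => A mA piA0; rewrite Qp//.
  by apply: null_set_integral => //; exact/measurable_funTS/measurable_EFinP.
rewrite /Rintegral; congr fine.
rewrite -(Radon_Nikodym_change_of_variables Qpi measurableT); last first.
  exact: bm_integrable.
have [mg _] := bg.
apply: ae_eq_integral => //.
- apply: emeasurable_funM; first exact/measurable_EFinP.
  exact: measurable_int (Radon_Nikodym_integrable _).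
- exact/measurable_EFinP/measurable_funM.
- rewrite [X in ae_eq _ _ _ X](_ : _ = (EFin \o g) \* (EFin \o p))%E//.
  apply: ae_eqe_mul2l.
  apply: integral_ae_eq => //.
  + exact: Radon_Nikodym_integrable.
  + exact/measurable_EFinP.
  + by move=> A _ mA; rewrite -Radon_Nikodym_integral//= Qp.
Qed.

Lemma Rintegral_gibbs pi h g : bm h -> bm g ->
  \int[gibbs pi h]_x g x =
  \int[pi]_x (g x * expR (h x - log_partition pi h)).
Proof.
move=> bh bg; apply: Rintegral_density => //.
  by apply/bm_expR/bmB => //; exact: bm_cst.
by move=> A mA; exact: gibbs_density.
Qed.

Lemma gibbs_expR pi h k : bm h -> bm k ->
  \int[gibbs pi h]_x expR (k x - h x) =
  expR (log_partition pi k - log_partition pi h).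
Proof.
move=> bh bk; rewrite Rintegral_gibbs//; last exact/bm_expR/bmB.
under eq_Rintegral do rewrite -expRD addrA subrK expRD mulrC.
by rewrite bm_RintegralZ ?expRD ?expR_log_partition 1?mulrC//; exact: bm_expR.
Qed.

Lemma log_partition_gibbs pi h g : bm h -> bm g ->
  log_partition (gibbs pi h) g =
  log_partition pi (fun x => h x + g x) - log_partition pi h.
Proof.
move=> bh bg; rewrite -[RHS]expRK -(gibbs_expR pi bh (bmD bh bg)).
by congr ln; apply: eq_Rintegral => x _; congr expR; rewrite addrAC subrr add0r.
Qed.

(** The Gibbs variational principle tested at the Gibbs measure of h: Jensen's
    inequality applied to [gibbs_expR]. Every entropy between Gibbs measures in
    the proof of the main bound is handled by this inequality. *)
Lemma gibbs_log_partition pi h k : bm h -> bm k ->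
  \int[gibbs pi h]_x (k x - h x) <= log_partition pi k - log_partition pi h.
Proof.
move=> bh bk; rewrite -ler_expR -gibbs_expR//.
by apply: expR_Jensen; exact: bmB.
Qed.

(** The upper function may have an infinite integral, as the log-density in a
    relative entropy may; the negative part is controlled by [psi]. *)
Lemma le_integral_integrablel rho (psi u : T -> R) :
  rho.-integrable setT (EFin \o psi) -> measurable_fun setT u ->
  (forall x, psi x <= u x) ->
  (\int[rho]_x (psi x)%:E <= \int[rho]_x (u x)%:E)%E.
Proof.
move=> ipsi mu psiu.
have mpsi := measurable_int _ ipsi.
have mEu : measurable_fun setT (EFin \o u) by exact/measurable_EFinP.
have le_psiu : {in setT, forall x, ((EFin \o psi) x <= (EFin \o u) x)%E}.
  by move=> x _; rewrite /= lee_fin.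
rewrite integralE [leRHS]integralE; apply: leeB.
- apply: ge0_le_integral => //.
  + exact: measurable_funepos.
  + exact: measurable_funepos.
  + by move=> x /= _; apply: (funepos_le le_psiu); rewrite inE.
- apply: ge0_le_integral => //.
  + exact: measurable_funeneg.
  + exact: measurable_funeneg.
  + by move=> x /= _; apply: (funeneg_le le_psiu); rewrite inE.
Qed.

Lemma measurable_lne : measurable_fun setT (fun r : R => lne r%:E).
Proof.
rewrite (_ : (fun r : R => lne r%:E) =
    (fun r : R => if 0 < r then (ln r)%:E else -oo%E)); last first.
  apply/funext => r; case: ltP => r0; first by rewrite lne_EFin.
  by rewrite le0_lneNy.
apply: measurable_fun_if => //.
- exact: measurable_fun_ltr.
- exact/measurable_funTS/measurable_EFinP.
Qed.

(** With u the density of rho and c the log-partition function of g, the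
    inequality 1 + v <= exp v at v = g - c - log u bounds log u from below by
    g - c + 1 - k, where the rho-integral of k = exp (g - c) / u is at most 1. *)
Lemma Donsker_Varadhan pi rho g : bm g ->
  ((\int[rho]_x g x)%:E <= KL rho pi + (log_partition pi g)%:E)%E.
Proof.
move=> bg; have [mg [M gM]] := bg.
rewrite /KL; case: asboolP => [rhopi|_]; last by rewrite addye// leey.
set c := log_partition pi g.
pose RN := Radon_Nikodym_SigmaFinite.f rho pi.
have RN_ge0 x : (0 <= RN x)%E by exact: Radon_Nikodym_SigmaFinite.f_ge0.
have RN_fin x : RN x \is a fin_num by exact: Radon_Nikodym_SigmaFinite.f_fin_num.
have mRN : measurable_fun setT RN.
  exact: measurable_int (Radon_Nikodym_SigmaFinite.f_integrable rhopi).
pose u x := fine (RN x).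
have uE x : (u x)%:E = RN x by rewrite fineK.
have mu : measurable_fun setT u.
  exact: measurableT_comp.
have u_ge0 x : 0 <= u x by rewrite fine_ge0.
have u_gt0 : {ae rho, forall x, 0 < u x}.
  exists [set x | u x <= 0]; split.
  - rewrite -[X in measurable X]setTI.
    exact: measurable_fun_le.
  - rewrite (Radon_Nikodym_SigmaFinite.f_integral rhopi)//; last first.
      rewrite -[X in measurable X]setTI.
      exact: measurable_fun_le.
    apply: integral0_eq => x /= ux0; apply/eqP.
    by rewrite eq_le RN_ge0 -[leLHS]uE lee_fin ux0.
  - by move=> x /= /negP; rewrite -leNgt.
have mlnu : measurable_fun setT (fun x => ln (u x)).
  exact: measurableT_comp.
have -> : (\int[rho]_x lne (Radon_Nikodym (charge_of_finite_measure rho) pi x) =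
           \int[rho]_x (ln (u x))%:E)%E.
  apply: ae_eq_integral => //.
  - rewrite (_ : (fun x => _) =
      (fun r : R => lne r%:E) \o (fun x =>
        fine (Radon_Nikodym (charge_of_finite_measure rho) pi x))); last first.
      apply/funext => x; rewrite [RHS]/comp fineK//.
      exact: Radon_Nikodym_fin_num.
    apply: measurableT_comp; first exact: measurable_lne.
    apply: measurableT_comp => //.
  - exact/measurable_EFinP.
  - have := ae_eq_Radon_Nikodym_SigmaFinite rhopi measurableT.
    move=> /(null_dominates_ae_eq measurableT rhopi) RNE.
    apply: filterS2 u_gt0 RNE => x ux RNx _ /=.
    by rewrite -RNx// -/(RN x) -uE lne_EFin.
(* Where u vanishes, ln u = 0 and k is harmless, since k is multiplied by u in
   the change of variables. *)
pose k x := expR (g x - c - ln (u x)).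
have mk : measurable_fun setT k.
  apply: measurableT_comp => //; apply: measurable_funB => //.
  exact: measurable_funB.
have k_ge0 x : 0 <= k x by exact: expR_ge0.
have be : bm (fun x => expR (g x - c)).
  by apply/bm_expR/bmB => //; exact: bm_cst.
have ik : (\int[rho]_x (k x)%:E <= 1)%E.
  rewrite -(Radon_Nikodym_SigmaFinite.change_of_variables rhopi)//; last first.
    exact/measurable_EFinP.
  have <- : (\int[pi]_x (expR (g x - c))%:E = 1)%E.
    rewrite -bm_EFin_Rintegral//; under eq_Rintegral do rewrite expRD mulrC.
    rewrite bm_RintegralZ; last exact: bm_expR.
    by rewrite -expR_log_partition// -expRD addNr expR0.
  apply: ge0_le_integral => //.
  - by move=> x _; rewrite mule_ge0// lee_fin.
  - by apply: emeasurable_funM => //; exact/measurable_EFinP.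
  - by apply/measurable_EFinP; case: be.
  - move=> x _; rewrite -/(RN x) -uE -EFinM lee_fin /k.
    have := u_ge0 x; rewrite le_eqVlt => /orP[/eqP<-|ux].
      by rewrite mulr0 expR_ge0.
    by rewrite expRB lnK ?posrE// divfK// gt_eqF.
have ik' : rho.-integrable setT (EFin \o k).
  apply/integrableP; split; first exact/measurable_EFinP.
  under eq_integral do rewrite /= ger0_norm//.
  by rewrite (le_lt_trans ik)// ltry.
have bg1 : bm (fun x => g x - c + 1).
  by apply: bmD; [apply: bmB => //|]; exact: bm_cst.
have ipsi : rho.-integrable setT (EFin \o (fun x => g x - c + 1 - k x)).
  rewrite [X in _.-integrable _ X](_ : _ =
    ((EFin \o (fun x => g x - c + 1)%R) \- (EFin \o k))%E)//.
  by apply: integrableB => //; exact: bm_integrable.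
rewrite -leeBlDr//; apply: (@le_trans _ _ (\int[rho]_x (g x - c + 1 - k x)%:E)%E).
  under [leRHS]eq_integral do rewrite EFinB.
  rewrite integralB//; last exact: bm_integrable.
  rewrite -bm_EFin_Rintegral// bm_RintegralD; last 2 first.
    - by apply: bmB => //; exact: bm_cst.
    - exact: bm_cst.
  rewrite bm_RintegralB//; last exact: bm_cst.
  by rewrite !Rintegral_prob_cst EFinD EFinB -addeA leeDl// sube_ge0// orbT.
apply: le_integral_integrablel => //= x.
have := expR_ge1Dx (g x - c - ln (u x)); rewrite -/(k x); lra.
Qed.

End gibbs_variational.

(** * The deviation function *)

Section hyperbolic_theory.
Context (R : realType).
Implicit Types x psi : R.

Lemma cosh_ge1 x : 1 <= cosh x.
Proof.
have := sqr_ge0 (expR (x / 2) - expR (- (x / 2))).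
rewrite sqrrB -expRD subrr expR0 -!expRM_natl !mulrN.
rewrite (_ : 2%:R * (x / 2) = x); last by field.
rewrite /cosh; lra.
Qed.

Lemma ln_cosh_ge0 x : 0 <= ln (cosh x).
Proof. exact/ln_ge0/cosh_ge1. Qed.

Lemma tanh_gt0 x : 0 < x -> 0 < tanh x.
Proof.
move=> x0; rewrite /tanh divr_gt0//; last by rewrite addr_gt0 ?expR_gt0.
by rewrite subr_gt0 ltr_expR gtrN.
Qed.

Lemma tanh_lt1 x : tanh x < 1.
Proof.
rewrite /tanh ltr_pdivrMr ?addr_gt0 ?expR_gt0// mul1r.
have := expR_gt0 (- x); lra.
Qed.

(** On {-1, 0, 1} the exponential is an affine function of psi, because
    1 - tanh x = exp (-x) / cosh x. This is where the constants tanh and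
    log cosh of the bound come from. *)
Lemma expR_lin_cosh x psi : psi = -1 \/ psi = 0 \/ psi = 1 ->
  expR (- (x * psi) - ln (cosh x) * `|psi|) = 1 - tanh x * psi.
Proof.
have cosh_gt0 : 0 < cosh x by exact: lt_le_trans (cosh_ge1 x).
have expxN : 0 < expR x + expR (- x) by rewrite addr_gt0 ?expR_gt0.
have := cosh_ge1 x.
move=> _ [|[|]] ->; rewrite /tanh.
- rewrite mulrN1 opprK normrN1 mulr1 expRB lnK ?posrE// /cosh.
  by field; rewrite gt_eqF.
- by rewrite normr0 !mulr0 !subr0 oppr0 expR0.
- rewrite !mulr1 normr1 mulr1 expRB lnK ?posrE// /cosh.
  by field; rewrite gt_eqF.
Qed.

End hyperbolic_theory.

Section deviation_function_theory.
Context (R : realType) (N : nat) (gamma : R).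
Hypotheses (N_gt0 : (0 < N)%N) (gamma_gt0 : 0 < gamma).
Implicit Types alpha x y z : R.

Local Notation t := (tanh (gamma / N%:R)).

Let N0 : 0 < N%:R :> R. Proof. by rewrite ltr0n. Qed.
Let t_gt0 : 0 < t. Proof. by rewrite tanh_gt0// divr_gt0. Qed.
Let t_lt1 : t < 1. Proof. exact: tanh_lt1. Qed.

Lemma one_sub_tanhM_gt0 x : x < t^-1 -> 0 < 1 - t * x.
Proof. by rewrite -[t^-1]mul1r ltr_pdivlMr// mulrC subr_gt0. Qed.

Lemma lt_tanhV x : x <= 1 -> x < t^-1.
Proof. by move=> x1; rewrite (le_lt_trans x1)// invf_gt1. Qed.

Lemma slope_lt beta l : 0 < l -> beta * gamma / N%:R * t^-1 < l ->
  beta * gamma / l < N%:R * t.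
Proof.
move=> l0 lt_l; rewrite ltr_pdivrMr//.
have Nt0 : 0 < N%:R * t by exact: mulr_gt0.
rewrite -ltr_pdivrMl// (_ : _^-1 * _ = beta * gamma / N%:R * t^-1)//.
by field; rewrite !gt_eqF.
Qed.

(** Convexity of F, in the only form that is used: it lies above its
    tangents. *)
Lemma F_tangent alpha x z : x < t^-1 -> z < t^-1 ->
  F N gamma alpha x + (N%:R * t / (1 - t * x) - alpha) * (z - x)
    <= F N gamma alpha z.
Proof.
move=> /one_sub_tanhM_gt0; set u := 1 - t * x => u0.
move=> /one_sub_tanhM_gt0; set v := 1 - t * z => v0.
have le_lnv : ln v <= ln u + (v - u) / u.
  have vu : 0 < v / u by rewrite divr_gt0.
  have -> : v = u * (v / u) by rewrite mulrCA divff ?mulr1// gt_eqF.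
  rewrite lnM ?posrE// lerD2l.
  have := @le_ln1Dx _ (v / u - 1).
  rewrite (_ : 1 + _ = v / u); last lra.
  rewrite (_ : (u * (v / u) - u) / u = v / u - 1); last by field; rewrite gt_eqF.
  by apply; lra.
rewrite /F -/u -/v.
move: le_lnv; rewrite (_ : (v - u) / u = - (t / u * (z - x))); last first.
  by rewrite /v /u; field; rewrite -/u gt_eqF.
move=> /(ler_wpM2l (ltW N0)); rewrite (_ : N%:R * t / u = N%:R * (t / u)); last lra.
move: (t / u) => c; lra.
Qed.

Lemma F0 alpha : F N gamma alpha 0 = 0.
Proof. by rewrite /F !mulr0 !subr0 ln1 mulr0. Qed.

Lemma F_ge_lin alpha x : x < t^-1 ->
  (N%:R * t - alpha) * x <= F N gamma alpha x.
Proof.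
move=> xt; have := @F_tangent alpha 0 x.
by rewrite F0 add0r mulr0 !subr0 divr1; apply=> //; rewrite invr_gt0.
Qed.

(** Depending on the sign of the slope of F at x, the tangent at x bounds F x by
    its value at z or by its value 0 at the origin. *)
Lemma F_le_max alpha x z : 0 <= x <= z -> z < t^-1 ->
  F N gamma alpha x <= 0 \/ F N gamma alpha x <= F N gamma alpha z.
Proof.
move=> /andP[x0 xz] zt; have xt := le_lt_trans xz zt.
have [s0|s0] := leP 0 (N%:R * t / (1 - t * x) - alpha).
- right; apply: le_trans (F_tangent alpha xt zt).
  by rewrite lerDl mulr_ge0// subr_ge0.
- left; have := @F_tangent alpha x 0 xt; rewrite F0 sub0r mulrN subr_le0.
  rewrite invr_gt0 => /(_ t_gt0)/le_trans; apply.
  by rewrite mulr_le0_ge0// ltW.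
Qed.

Lemma bm_F d (T : measurableType d) alpha (h : T -> R) :
  bounded_measurable h -> (forall p, -1 <= h p <= 1) ->
  bounded_measurable (fun p => F N gamma alpha (h p)).
Proof.
move=> bh h1; rewrite /F; apply: bmB; last exact: bmZ.
apply: bmZ; split.
  apply: measurableT_comp => //; apply: measurable_funB => //.
  by apply: measurable_funM => //; case: bh.
exists (`|ln (1 - t)| + `|ln (1 + t)|) => p.
have /andP[hp1 hp2] := h1 p.
have le1 : 1 - t <= 1 - t * h p.
  by rewrite lerD2l lerN2 -[leRHS]mulr1 ler_wpM2l// ltW.
have le2 : 1 - t * h p <= 1 + t.
  by rewrite lerD2l -mulrN -[leRHS]mulr1 ler_wpM2l ?(ltW t_gt0)//; lra.
have ln1 : ln (1 - t) <= ln (1 - t * h p).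
  by rewrite ler_ln// posrE; move: t_lt1; lra.
have ln2 : ln (1 - t * h p) <= ln (1 + t).
  by rewrite ler_ln// posrE; move: t_lt1; lra.
have := ler_norm (ln (1 + t)); have := ler_norm (- ln (1 - t)); rewrite normrN.
have := normr_ge0 (ln (1 + t)); have := normr_ge0 (ln (1 - t)).
by rewrite ler_norml; lra.
Qed.

Section inverse.
Variable alpha : R.
Hypothesis alpha_lt : alpha < N%:R * t.

Lemma F_inv_ge0 y : 0 <= F_inv N gamma alpha y.
Proof. by rewrite /F_inv; case: xgetP => // x _ [] /andP[]. Qed.

Lemma F_invP y : 0 <= y ->
  0 <= F_inv N gamma alpha y < t^-1 /\ F N gamma alpha (F_inv N gamma alpha y) = y.
Proof.
move=> y0; suff [x xP] : exists x, 0 <= x < t^-1 /\ F N gamma alpha x = y.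
  by rewrite /F_inv; case: xgetP => [z _ []|/(_ x)/(_ xP)].
(* At b = (1 - exp (-K)) / t the logarithmic term of F is N K, while the linear
   one is at most N: the choice K = 1 + y / N makes F b at least y. *)
pose K := 1 + y / N%:R.
have K1 : 1 <= K by rewrite lerDl divr_ge0// ltW.
pose b := (1 - expR (- K)) / t.
have eK1 : expR (- K) < 1 by rewrite expR_lt1; lra.
have eK0 : 0 < expR (- K) by exact: expR_gt0.
have b0 : 0 <= b by rewrite divr_ge0// ltW// subr_gt0.
have bt : b < t^-1 by rewrite -[ltRHS]mul1r ltr_pM2r ?invr_gt0//; lra.
have yFb : y <= F N gamma alpha b.
  rewrite /F (_ : 1 - t * b = expR (- K)); last first.
    by rewrite /b; field; rewrite gt_eqF.
  rewrite expRK.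
  have -> : y = N%:R * K - N%:R by rewrite /K; field; rewrite gt_eqF.
  have : alpha * b <= N%:R * t * b by rewrite ler_wpM2r// ltW.
  have -> : N%:R * t * b = N%:R * (1 - expR (- K)) by rewrite /b; field; rewrite gt_eqF.
  by have := mulr_gt0 N0 eK0; lra.
have Fc : {within `[0, b], continuous (F N gamma alpha)}.
  apply: continuous_in_subspaceT => x; rewrite inE/= in_itv/= => /andP[x0 xb].
  have u0 : 0 < 1 - t * x by apply: one_sub_tanhM_gt0; exact: le_lt_trans bt.
  apply: cvgB; last by apply: cvgM; [exact: cvg_cst|exact: cvg_id].
  apply: cvgM; first exact: cvg_cst.
  apply: (@continuous_comp _ _ _ (fun x => 1 - t * x) (@ln R)); last first.
    exact: continuous_ln.
  apply: cvgB; first exact: cvg_cst.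
  by apply: cvgM; [exact: cvg_cst|exact: cvg_id].
have [|c] := @IVT _ (F N gamma alpha) 0 b y b0 Fc.
  by rewrite F0 ge_min y0 le_max yFb orbT.
rewrite in_itv/= => /andP[c0 cb] Fcy; exists c; split=> //.
by rewrite c0 (le_lt_trans cb).
Qed.

Lemma le_F_inv y z : 0 <= y -> z < t^-1 -> F N gamma alpha z <= y ->
  z <= F_inv N gamma alpha y.
Proof.
move=> y0 zt Fzy; have [/andP[x0 xt] Fx] := F_invP y0.
move: x0 xt Fx; set x := F_inv _ _ _ _ => x0 xt Fx.
rewrite leNgt; apply/negP => xz.
have := F_tangent alpha xt zt; rewrite Fx => H.
have u0 := one_sub_tanhM_gt0 xt.
have : N%:R * t <= N%:R * t / (1 - t * x).
  apply: ler_peMr; first by rewrite mulr_ge0// ltW.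
  by rewrite invf_ge1// gerBl mulr_ge0// ltW.
move=> H2; have : 0 < (N%:R * t / (1 - t * x) - alpha) * (z - x).
  by rewrite mulr_gt0 ?subr_gt0// (lt_le_trans alpha_lt).
lra.
Qed.

Lemma F_inv_le y : 0 <= y -> F_inv N gamma alpha y <= y / (N%:R * t - alpha).
Proof.
move=> y0; have [/andP[x0 xt] Fx] := F_invP y0.
by rewrite ler_pdivlMr ?subr_gt0// mulrC -[leRHS]Fx F_ge_lin.
Qed.

End inverse.

End deviation_function_theory.

(** * The deterministic bound on the deviation event *)

Section bounded_fubini.
Context d1 d2 (T1 : measurableType d1) (T2 : measurableType d2) (R : realType).
Variables (P1 : probability T1 R) (P2 : probability T2 R) (k : T1 * T2 -> R).
Hypothesis bk : bounded_measurable k.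

Lemma bm_pair1 x : bounded_measurable (fun y => k (x, y)).
Proof. exact: (bm_comp bk). Qed.

Lemma bm_pair2 y : bounded_measurable (fun x => k (x, y)).
Proof. exact: (bm_comp bk). Qed.

Lemma bm_Rintegral2 : bounded_measurable (fun x => \int[P2]_y k (x, y)).
Proof.
have [_ [M kM]] := bk; split; last first.
  exists M => x; rewrite ler_norml; apply/andP; split.
    apply: bm_Rintegral_ge; first exact: bm_pair1.
    by move=> y; have := kM (x, y); rewrite ler_norml => /andP[].
  apply: bm_Rintegral_le; first exact: bm_pair1.
  by move=> y; have := kM (x, y); rewrite ler_norml => /andP[].
rewrite (_ : (fun _ => _) = (fun x => \int[P2]_y (k (x, y) + M) - M)); last first.
  apply/funext => x; rewrite bm_RintegralD; last 2 first.
  - exact: bm_pair1.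
  - exact: bm_cst.
  by rewrite Rintegral_prob_cst addrK.
apply: measurable_funB => //; apply: measurableT_comp => //.
apply: (@measurable_fun_fubini_tonelli_F _ _ _ _ _ _
  (fun p => (k p + M)%:E)).
  by apply/measurable_EFinP/measurable_funD => //; case: bk.
by move=> p; rewrite lee_fin -lerBlDr sub0r; have := kM p; rewrite ler_norml => /andP[].
Qed.

Lemma bm_fubini :
  \int[P1]_x \int[P2]_y k (x, y) = \int[P2]_y \int[P1]_x k (x, y).
Proof.
have ik := bm_integrable (P1 \x P2)%E bk.
rewrite /Rintegral; congr fine.
under eq_integral => x _.
  rewrite fineK; last first.
    by apply: integrable_fin_num => //; apply: bm_integrable; exact: bm_pair1.
  over.
under [RHS]eq_integral => y _.
  rewrite fineK; last first.
    by apply: integrable_fin_num => //; apply: bm_integrable; exact: bm_pair2.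
  over.
exact: (Fubini ik).
Qed.

End bounded_fubini.

(** In this section [r] stands for the empirical risk at a fixed sample, [rk]
    for the risk and [m] for the empirical distance. *)
Section relative_bound_core.
Context d (Theta : measurableType d) (R : realType).
Variables (N : nat) (prior : probability Theta R).
Variables (r rk : Theta -> R) (m : Theta -> Theta -> R).
Hypotheses (N_gt0 : (0 < N)%N).
Hypotheses (br : bounded_measurable r) (bR : bounded_measurable rk).
Hypothesis (rk01 : forall x, 0 <= rk x <= 1).
Hypothesis bm_m : bounded_measurable (fun p => m p.1 p.2).
Hypothesis m_sym : forall x y, m x y = m y x.
Hypothesis m_ge0 : forall x y, 0 <= m x y.
Hypothesis m_triangle : forall x y z, m x z <= m x y + m y z.
Implicit Types rho mu : probability Theta R.

Local Notation bm := (@bounded_measurable _ Theta R).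
Local Notation Lam h := (log_partition prior h).

Definition mean_dist rho y : R := \int[rho]_x m x y.

Lemma bm_mean_dist rho : bm (mean_dist rho).
Proof.
rewrite (_ : mean_dist rho = fun x => \int[rho]_y m x y); last first.
  by apply/funext => x; apply: eq_Rintegral => y _; rewrite m_sym.
exact: (bm_Rintegral2 rho bm_m).
Qed.

Lemma mean_dist_ge0 rho y : 0 <= mean_dist rho y.
Proof. exact: Rintegral_ge0. Qed.

Definition dist rho mu : R := \int[mu]_y mean_dist rho y.

Lemma dist_sym rho mu : dist rho mu = dist mu rho.
Proof.
rewrite /dist /mean_dist.
under eq_Rintegral do under eq_Rintegral do rewrite m_sym.
by rewrite (bm_fubini mu rho bm_m).
Qed.

Lemma dist_triangle rho mu nu : dist rho nu <= dist rho mu + dist mu nu.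
Proof.
rewrite -[dist rho mu](Rintegral_prob_cst nu) -bm_RintegralD; last 2 first.
- exact: bm_cst.
- exact: bm_mean_dist.
apply: bm_le_Rintegral.
- exact: bm_mean_dist.
- by apply: bmD; [exact: bm_cst|exact: bm_mean_dist].
move=> z.
rewrite -[leLHS](Rintegral_prob_cst mu) -bm_RintegralD; last 2 first.
- exact: bm_mean_dist.
- exact: (bm_pair2 bm_m).
apply: bm_le_Rintegral.
- exact: bm_cst.
- by apply: bmD; [exact: bm_mean_dist|exact: (bm_pair2 bm_m)].
move=> y; rewrite -[m y z](Rintegral_prob_cst rho) -bm_RintegralD; last 2 first.
- exact: (bm_pair2 bm_m).
- exact: bm_cst.
apply: bm_le_Rintegral.
- exact: (bm_pair2 bm_m).
- by apply: bmD; [exact: (bm_pair2 bm_m)|exact: bm_cst].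
by move=> x; exact: m_triangle.
Qed.

Variables (beta gamma E : R).
Hypotheses (beta_gt0 : 0 < beta) (gamma_gt0 : 0 < gamma) (E_ge0 : 0 <= E).

Local Notation t := (tanh (gamma / N%:R)).
Local Notation M := (N%:R * ln (cosh (gamma / N%:R))).
Local Notation mu := (gibbs prior (fun x => - beta * rk x)).

Definition deviation (x y : Theta) : R :=
  F N gamma 0 (rk x - rk y) - gamma * (r x - r y) - M * m x y.

(** [E] plays the role of the negated logarithm of the confidence level. *)
Definition deviation_event :=
  \int[mu]_x \int[mu]_y expR (deviation x y) <= expR E.

Hypothesis event : deviation_event.

Lemma Rintegral01 rho : 0 <= \int[rho]_x rk x <= 1.
Proof.
apply/andP; split.
- by apply: bm_Rintegral_ge => // x; have /andP[] := rk01 x.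
- by apply: bm_Rintegral_le => // x; have /andP[] := rk01 x.
Qed.

Lemma lt_tanhV_sub (a b : R) : 0 <= a <= 1 -> 0 <= b <= 1 -> a - b < t^-1.
Proof. by move=> /andP[_ a1] /andP[b0 _]; apply: lt_tanhV => //; lra. Qed.

Lemma bm_deviation : bounded_measurable (fun p => deviation p.1 p.2).
Proof.
have bfst (h : Theta -> R) : bm h ->
    bounded_measurable (fun p : Theta * Theta => h p.1).
  by move=> bh; exact: bm_comp bh measurable_fst.
have bsnd (h : Theta -> R) : bm h ->
    bounded_measurable (fun p : Theta * Theta => h p.2).
  by move=> bh; exact: bm_comp bh measurable_snd.
apply: bmB; last exact: bmZ.
apply: bmB; last by apply: bmZ; apply: bmB; [exact: bfst|exact: bsnd].
apply: (bm_F N_gt0 gamma_gt0 0 (h := fun p => rk p.1 - rk p.2)).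
  by apply: bmB; [exact: bfst|exact: bsnd].
move=> [x y] /=; have /andP[x0 x1] := rk01 x; have /andP[y0 y1] := rk01 y.
lra.
Qed.

(** Dual form of K(rho, pi_exp(-l r)) <= k. It avoids densities, and it is
    obtained from [Donsker_Varadhan] for an arbitrary posterior and from
    [gibbs_log_partition], with k = 0, for the Gibbs posterior itself. *)
Definition entropy_le rho (l k : R) := forall g, bm g ->
  \int[rho]_x g x <=
  Lam (fun x => - l * r x + g x) - Lam (fun x => - l * r x) + k.

Lemma bm_scale_r (l : R) : bm (fun x => - l * r x). Proof. exact: bmZ. Qed.

Lemma bm_scale_rk (l : R) : bm (fun x => - l * rk x). Proof. exact: bmZ. Qed.

Lemma F_shift (alpha z : R) : F N gamma alpha z = F N gamma 0 z - alpha * z.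
Proof. by rewrite /F mul0r subr0. Qed.

Local Notation excess rho := (\int[rho]_x rk x - \int[mu]_x rk x).

(** Linear arithmetic in which integrals, log-partition functions and values of
    F are opaque atoms. *)
Ltac lra_atoms := repeat match goal with
  | |- context [log_partition ?a ?b] => generalize (log_partition a b)
  | |- context [F ?n ?a ?b ?c] => generalize (F n a b c)
  | |- context [F_inv ?n ?a ?b ?c] => generalize (F_inv n a b c)
  | |- context [dist ?a ?b] => generalize (dist a b)
  | |- context [Rintegral ?a ?b ?c] => generalize (Rintegral a b c)
  | |- context [ln ?a] => generalize (ln a)
  end;
  repeat match goal with
  | H : context [@Rintegral] |- _ => clear H
  | H : context [@log_partition] |- _ => clear H
  | H : context [@F_inv] |- _ => clear H
  | H : context [@F] |- _ => clear H
  | H : context [@tanh] |- _ => clear H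
  end;
  repeat match goal with x := _ |- _ => clearbody x end; intros; lra.

(** The deviation is linearized by the tangent of F at the mean [x0], so that
    its integral over y is at least a function [g0] of x alone, affine in the
    risk. The duality of [entropy_le] is applied to the sum of g0 and of the
    log-density, up to a constant, of mu with respect to pi_exp(-l r). *)
Lemma posterior_bound rho (l k : R) : entropy_le rho l k ->
  F N gamma 0 (excess rho) - gamma * (\int[rho]_x r x - \int[mu]_x r x)
    - M * dist mu rho - beta * \int[rho]_x rk x + l * \int[rho]_x r x
  <= Lam (fun x => - beta * rk x) + E - Lam (fun x => - l * r x) + k.
Proof.
move=> ent; set x0 := excess rho.
set s := N%:R * t / (1 - t * x0).
set mR := \int[mu]_x rk x; set mr := \int[mu]_x r x.
have x0t : x0 < t^-1 by apply: lt_tanhV_sub; exact: Rintegral01.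
pose a x := s * (rk x - mR - x0) - gamma * (r x - mr) - M * mean_dist mu x.
pose g0 x := F N gamma 0 x0 + a x.
have ba1 : bm (fun x => rk x - mR - x0) by do 2 (apply: bmB; last exact: bm_cst).
have ba2 : bm (fun x => r x - mr) by apply: bmB => //; exact: bm_cst.
have ba3 := bm_mean_dist mu.
have ba : bm a by apply: bmB; [apply: bmB|]; exact: bmZ.
have bg0 : bm g0 by apply: bmD => //; exact: bm_cst.
have g0_le x : g0 x <= \int[mu]_y deviation x y.
  have -> : g0 x = \int[mu]_y (F N gamma 0 x0 + (s * (rk x - rk y - x0) -
      gamma * (r x - r y) - M * m x y)).
    have bm1 : bm (fun y => m x y) by exact: (bm_pair1 bm_m).
    have bc (c : R) : bm (fun=> c) by exact: bm_cst.
    have bs1 : bm (fun y => rk x - rk y - x0) by do 2 apply: bmB => //.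
    have bs2 : bm (fun y => r x - r y) by apply: bmB.
    have bs3 : bm (fun y => s * (rk x - rk y - x0) - gamma * (r x - r y)).
      by apply: bmB; exact: bmZ.
    rewrite bm_RintegralD//; last by apply: bmB => //; exact: bmZ.
    rewrite Rintegral_prob_cst.
    rewrite bm_RintegralB//; last exact: bmZ.
    rewrite bm_RintegralB//; [|exact: bmZ|exact: bmZ].
    rewrite !bm_RintegralZ//.
    have -> : \int[mu]_y (rk x - rk y - x0) = rk x - mR - x0.
      have bs4 : bm (fun y => rk x - rk y) by exact: bmB.
      by rewrite bm_RintegralB// bm_RintegralB// !Rintegral_prob_cst.
    have -> : \int[mu]_y (r x - r y) = r x - mr.
      by rewrite bm_RintegralB// !Rintegral_prob_cst.
    rewrite /g0 /a /mean_dist; congr (_ + _); congr (_ + _); congr (- (_ * _)).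
    by apply: eq_Rintegral => y _; rewrite m_sym.
  have bc (c : R) : bm (fun=> c) by exact: bm_cst.
  apply: bm_le_Rintegral.
  - apply: bmD => //; apply: bmB; last exact/bmZ/(bm_pair1 bm_m).
    apply: bmB; apply: bmZ; last exact: bmB.
    by do 2 apply: bmB => //.
  - exact: (bm_pair1 bm_deviation).
  move=> y; rewrite /deviation.
  have := @F_tangent _ N gamma N_gt0 gamma_gt0 0 x0 (rk x - rk y) x0t.
  rewrite subr0 -/s => /(_ (lt_tanhV_sub (rk01 x) (rk01 y))); lra.
have int_g0 : \int[mu]_x expR (g0 x) <= expR E.
  apply: le_trans event; apply: bm_le_Rintegral.
  - exact: bm_expR.
  - apply: (bm_Rintegral2 mu (k := fun p => expR (deviation p.1 p.2))).
    exact/bm_expR/bm_deviation.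
  move=> x; apply: (@le_trans _ _ (expR (\int[mu]_y deviation x y))).
    by rewrite ler_expR.
  by apply: expR_Jensen; exact: (bm_pair1 bm_deviation).
have Lam_g0 : Lam (fun x => - beta * rk x + g0 x) -
    Lam (fun x => - beta * rk x) <= E.
  rewrite -ler_expR -gibbs_expR; last 2 first.
  - exact: bm_scale_rk.
  - by apply: bmD => //; exact: bm_scale_rk.
  by under eq_Rintegral do rewrite addrAC subrr add0r.
pose g x := l * r x - beta * rk x + g0 x.
have bg : bm g by apply: bmD => //; apply: bmB; exact: bmZ.
have := ent g bg.
rewrite (_ : (fun x => - l * r x + g x) = (fun x => - beta * rk x + g0 x)); last first.
  by apply/funext => x; rewrite /g; move: (g0 x) (r x) (rk x) => *; ring.
have -> : \int[rho]_x g x = l * \int[rho]_x r x - beta * \int[rho]_x rk x +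
    (F N gamma 0 x0 - gamma * (\int[rho]_x r x - mr) - M * dist mu rho).
  have bc (c : R) : bm (fun=> c) by exact: bm_cst.
  rewrite /g bm_RintegralD//; last by apply: bmB; exact: bmZ.
  rewrite bm_RintegralB; [|exact: bmZ|exact: bmZ].
  rewrite !bm_RintegralZ//; congr (_ + _).
  rewrite /g0 bm_RintegralD// Rintegral_prob_cst /a.
  rewrite bm_RintegralB; [|by apply: bmB; exact: bmZ|exact: bmZ].
  rewrite bm_RintegralB; [|exact: bmZ|exact: bmZ].
  rewrite !bm_RintegralZ// !bm_RintegralB//; last exact: bmB.
  rewrite !Rintegral_prob_cst -/(dist mu rho) /x0 -/mR subrr mulr0.
  rewrite /mr; lra_atoms.
move: Lam_g0; rewrite /mr; lra_atoms.
Qed.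

Local Notation V rho := (fun y => M * mean_dist rho y).
Local Notation gibbs_r l := (gibbs prior (fun x => - l * r x)).

Lemma bm_V rho : bm (V rho).
Proof. by apply: bmZ; exact: bm_mean_dist. Qed.

Lemma ln_exp_distE (l : R) rho :
  ln (\int[gibbs_r l]_y expR (V rho y)) =
  Lam (fun x => - l * r x + V rho x) - Lam (fun x => - l * r x).
Proof.
by apply: log_partition_gibbs; [exact: bm_scale_r|exact: bm_V].
Qed.

Lemma M_ge0 : 0 <= M.
Proof. by rewrite mulr_ge0// ln_cosh_ge0. Qed.

Lemma ln_exp_dist_ge0 (l : R) rho : 0 <= ln (\int[gibbs_r l]_y expR (V rho y)).
Proof.
apply: ln_ge0; apply: bm_Rintegral_ge; first exact/bm_expR/bm_V.
move=> y; rewrite -[leLHS]expR0 ler_expR; apply: mulr_ge0; first exact: M_ge0.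
exact: mean_dist_ge0.
Qed.

(** The left-hand side is the mean of the potential -l r + M m' under the Gibbs
    measure of h, minus its entropy: a lower bound on the log-partition function
    of that potential. *)
Lemma dist_gibbs_le (l : R) rho h : bm h ->
  M * dist rho (gibbs prior h) - l * \int[gibbs prior h]_x r x
    - \int[gibbs prior h]_x h x
  <= Lam (fun x => - l * r x + V rho x) - Lam h.
Proof.
move=> bh; have bV := bm_V rho; have bl := bm_scale_r l.
have /= H := gibbs_log_partition prior bh (bmD bl bV).
apply: le_trans H.
rewrite bm_RintegralB//; last exact: bmD.
rewrite bm_RintegralD// !bm_RintegralZ//; last exact: bm_mean_dist.
by rewrite /dist; lra.
Qed.

(** The sum of the entropies of the two Gibbs measures with respect to each
    other is nonnegative, and the log-partition functions cancel in it. *)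
Lemma gibbs_order (l : R) :
  l * (\int[gibbs_r l]_x r x - \int[mu]_x r x) <= beta * excess (gibbs_r l).
Proof.
have bl := bm_scale_r l; have bb := bm_scale_rk beta.
have := gibbs_log_partition prior bl bb; have := gibbs_log_partition prior bb bl.
rewrite !bm_RintegralB// !bm_RintegralZ//; lra_atoms.
Qed.

(** With q = pi_exp(-l2 r) and d0 = q (r) - mu (r), either d0 is at most the
    F_inv term ([case1], comparison through mu), or (l2 - gamma) d0 dominates
    the exponential moment L2 ([case2], comparison through q). *)
Lemma relative_bound rho (l1 l2 k : R) : 0 <= l1 <= gamma ->
  beta * gamma / N%:R * t^-1 < l2 -> entropy_le rho l1 k ->
  F N gamma beta (excess rho) <=
  k + ((gamma - l1) * (\int[rho]_x r x - \int[gibbs_r l2]_x r x)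
       + ln (\int[gibbs_r l1]_y expR (V rho y)) + E
       + (gamma - l1) * (beta / l2) *
         F_inv N gamma (beta * gamma / l2)
           (ln (\int[gibbs_r l2]_y expR (V (gibbs_r l2) y)) + E)).
Proof.
move=> /andP[l10 l1g] l2t ent.
set q := gibbs_r l2; set L1 := ln _; set L2 := ln (\int[q]_y _).
set a := beta / l2; set xh := F_inv _ _ _ _.
have N0 : 0 < N%:R :> R by rewrite ltr0n.
have t0 : 0 < t by rewrite tanh_gt0// divr_gt0.
have l20 : 0 < l2 by apply: lt_trans l2t; rewrite !mulr_gt0 ?invr_gt0.
have a0 : 0 < a by rewrite divr_gt0.
have ag : beta * gamma / l2 < N%:R * t by exact: slope_lt.
have L20 : 0 <= L2 by exact: ln_exp_dist_ge0.
have y0 : 0 <= L2 + E by rewrite addr_ge0.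
have xh0 : 0 <= xh by exact: F_inv_ge0.
set d0 := \int[q]_x r x - \int[mu]_x r x.
have bb := bm_scale_rk beta; have bl2 := bm_scale_r l2.
have mub : \int[mu]_x (- beta * rk x) = - beta * \int[mu]_x rk x.
  by rewrite bm_RintegralZ.
have Ev := posterior_bound ent.
have L1E : L1 = Lam (fun x => - l1 * r x + V rho x) - Lam (fun x => - l1 * r x).
  exact: ln_exp_distE.
have L2E : L2 = Lam (fun x => - l2 * r x + V q x) - Lam (fun x => - l2 * r x).
  exact: ln_exp_distE.
have D1 := dist_gibbs_le l1 rho bb; rewrite mub in D1.
have D2 := dist_gibbs_le l2 q bb; rewrite mub in D2.
have g0 : 0 <= (gamma - l1) * (a * xh).
  by rewrite mulr_ge0 ?subr_ge0// mulr_ge0// ltW.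
rewrite dist_sym in Ev.
rewrite F_shift -mulrA.
have case1 : d0 <= a * xh ->
  F N gamma 0 (excess rho) - beta * excess rho <=
  k + ((gamma - l1) * (\int[rho]_x r x - \int[q]_x r x) + L1 + E
       + (gamma - l1) * (a * xh)).
  move=> d0a; have : (gamma - l1) * d0 <= (gamma - l1) * (a * xh).
    by rewrite ler_wpM2l// subr_ge0.
  by move: Ev D1; rewrite L1E /d0; lra_atoms.
have case2 : L2 <= (l2 - gamma) * d0 ->
  F N gamma 0 (excess rho) - beta * excess rho <=
  k + ((gamma - l1) * (\int[rho]_x r x - \int[q]_x r x) + L1 + E
       + (gamma - l1) * (a * xh)).
  move=> L2d; have D3 := dist_gibbs_le l1 rho bl2.
  rewrite bm_RintegralZ// in D3.
  have := ler_wpM2l M_ge0 (dist_triangle rho q mu).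
  rewrite mulrDr => D4.
  move: Ev D2 D3 D4 L2E L2d; rewrite L1E /d0 /q; lra_atoms.
have [d00|d0_gt0] := leP d0 0.
  by apply: case1; rewrite (le_trans d00)// mulr_ge0// ltW.
(* [x'] is the value of the excess risk of q at which the inequality of
   [gibbs_order] would be an equality. *)
pose x' := d0 / a; pose x2 := excess q.
have d0E : d0 = a * x' by rewrite /x' mulrCA divff ?mulr1// gt_eqF.
have x'0 : 0 <= x' by rewrite divr_ge0// ltW.
have x'x2 : x' <= x2.
  rewrite /x' ler_pdivrMr// /a mulrA ler_pdivlMr// mulrC.
  rewrite [leRHS]mulrC; exact: gibbs_order.
have x2t : x2 < t^-1 by apply: lt_tanhV_sub; exact: Rintegral01.
have x't : x' < t^-1 by exact: le_lt_trans x2t.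
have agd : beta * gamma / l2 * x' = gamma * d0.
  by rewrite d0E /a; field; rewrite gt_eqF.
(* Since F gamma (beta gamma / l2) x' = F gamma 0 x' - gamma d0, this is the
   monotonicity of F_inv. *)
have to_case1 : F N gamma 0 x' <= gamma * d0 + (L2 + E) -> d0 <= a * xh.
  move=> Fx'; rewrite d0E ler_wpM2l ?(ltW a0)//.
  by apply: le_F_inv => //; rewrite F_shift agd; move: Fx'; lra_atoms.
have x'b : 0 <= x' <= x2 by rewrite x'0.
have [Fx'|Fx'] := F_le_max N_gt0 gamma_gt0 beta x'b x2t.
  have [|dL] := leP (beta * x') (gamma * d0 + (L2 + E)).
    move=> H; apply/case1/to_case1; move: Fx' H; rewrite F_shift; lra_atoms.
  apply: case2; have : beta * x' = l2 * d0.
    by rewrite d0E /a; field; rewrite gt_eqF.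
  move: dL E_ge0; lra_atoms.
apply/case1/to_case1; move: Fx'; rewrite !(F_shift beta).
have ent2 : entropy_le q l2 0.
  move=> g bg; rewrite addr0.
  have := gibbs_log_partition prior bl2 (bmD bl2 bg).
  by under eq_Rintegral do rewrite addrAC subrr add0r.
have := posterior_bound ent2; rewrite -/x2 dist_sym.
have bx' : beta * x' = l2 * d0 by rewrite d0E /a; field; rewrite gt_eqF.
move: D2 L2E bx'; rewrite -/q /x2 /d0; lra_atoms.
Qed.

End relative_bound_core.

(** * The exponential moment inequality *)

Section product_expectation.
Context d (T : measurableType d) (R : realType).

Lemma measurable_prod_tnth n (g : 'I_n -> T -> R) :
  (forall i, measurable_fun setT (g i)) ->
  measurable_fun setT (fun w : n.-tuple T => \prod_(i < n) g i (tnth w i)).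
Proof.
move=> mg; apply: measurable_prod => i _.
by apply: measurableT_comp => //; exact: measurable_tnth.
Qed.

Lemma integral_product_probability n (P : 'I_n -> probability T R)
    (g : 'I_n -> T -> R) :
  (forall i, measurable_fun setT (g i)) -> (forall i x, 0 <= g i x) ->
  (\int[product_probability P]_w (\prod_(i < n) g i (tnth w i))%:E =
   \prod_(i < n) \int[P i]_x (g i x)%:E)%E.
Proof.
elim: n P g => [|n IHn] P g mg g0.
  under eq_integral do rewrite big_ord0.
  by rewrite big_ord0 integral_cst//= diracT mule1.
rewrite big_ord_recl -IHn//=.
rewrite ge0_integral_distribution; last 2 first.
- apply/measurable_EFinP. exact: (@measurable_prod_tnth n.+1 g mg).
- by move=> w; rewrite lee_fin prodr_ge0.
have mtail : measurable_fun setT (fun w : n.-tuple T =>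
    \prod_(i < n) g (lift ord0 i) (tnth w i)).
  exact: (@measurable_prod_tnth n (fun i => g (lift ord0 i))).
rewrite fubini_tonelli1; last 2 first.
- apply: measurableT_comp; last exact: measurable_funPT.
  by apply/measurable_EFinP; exact: (@measurable_prod_tnth n.+1 g mg).
- by move=> w; rewrite lee_fin prodr_ge0.
rewrite -ge0_integralZr//; last 3 first.
- exact/measurable_EFinP.
- by move=> x _; rewrite lee_fin.
- by apply: integral_ge0 => w _; rewrite lee_fin prodr_ge0.
apply: eq_integral => x _; rewrite /fubini_F.
rewrite -ge0_integralZl//; last 3 first.
- exact/measurable_EFinP.
- by move=> w _; rewrite lee_fin prodr_ge0.
- by rewrite lee_fin.
apply: eq_integral => w _; rewrite /= -EFinM big_ord_recl tnth0.
by congr ((_ * _)%:E); apply: eq_bigr => i _; rewrite tnthS.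
Qed.

End product_expectation.

Section sample.
Context (R : realType) (N : nat) (dX dY dT : measure_display)
  (X : measurableType dX) (Y : measurableType dY) (Theta : measurableType dT).
Variables (P : 'I_N -> probability (X * Y)%type R) (f : Theta -> X -> Y).
Hypotheses (N_gt0 : (0 < N)%N) (finY : finite_set [set: Y])
  (mY : forall A : set Y, measurable A)
  (mf : measurable_fun [set: (Theta * X)%type] (fun p => f p.1 p.2)).

Local Notation Omega := (N.-tuple (X * Y)%type).
Local Notation PP := (product_probability P).

(** Finiteness of Y makes the diagonal of Y * Y a finite union of rectangles. *)
Lemma measurable_err :
  measurable_fun setT (fun p : Theta * (X * Y) => err f p.1 p.2 : R).
Proof.
pose D := [set p : Theta * (X * Y) | f p.1 p.2.1 != p.2.2].
have mD : measurable D.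
  have -> : D = ~` \bigcup_(y in [set: Y])
      ([set p | f p.1 p.2.1 = y] `&` [set p | p.2.2 = y]).
    apply/seteqP; split => [p /= /eqP Dp [y _ [fy py]]|p /= Dp].
      by apply: Dp; rewrite fy py.
    by apply/eqP => fp; apply: Dp; exists p.2.2.
  apply: measurableC; apply: fin_bigcup_measurable => // y _.
  apply: measurableI; rewrite -[X in measurable X]setTI.
  - have m1 : measurable_fun setT (fun p : Theta * (X * Y) => f p.1 p.2.1).
      rewrite (_ : (fun _ => _) = (fun p => f p.1 p.2) \o
        (fun p : Theta * (X * Y) => (p.1, p.2.1)))//.
      apply: measurableT_comp => //; apply: measurable_fun_pair => //.
      exact: measurableT_comp.
    exact: (m1 measurableT [set y]).
  - have m2 : measurable_fun setT (fun p : Theta * (X * Y) => p.2.2).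
      exact: measurableT_comp.
    exact: (m2 measurableT [set y]).
rewrite (_ : (fun _ => _) = \1_D); first exact: measurable_indic.
apply/funext => p; rewrite indicE /err; congr (_%:R).
by rewrite mem_setE.
Qed.

Lemma err01 theta z : 0 <= (err f theta z : R) <= 1.
Proof. by rewrite /err; case: (_ != _); rewrite ?lexx ?ler01. Qed.

Lemma bm_err : bounded_measurable (fun p : Theta * (X * Y) => err f p.1 p.2 : R).
Proof.
split; first exact: measurable_err.
by exists 1 => p; have /andP[e0 e1] := err01 p.1 p.2; rewrite ger0_norm.
Qed.

Definition coord_risk i theta : R := \int[P i]_z err f theta z.

Lemma riskE theta : risk P f theta = N%:R^-1 * \sum_(i < N) coord_risk i theta.
Proof.
rewrite /risk; congr (_ * _); apply: eq_bigr => i _.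
pose D := [set z : X * Y | f theta z.1 != z.2].
have errE z : err f theta z = \1_D z :> R.
  by rewrite /err indicE mem_setE.
have mD : measurable D.
  rewrite (_ : D = (fun z => err f theta z : R) @^-1` [set 1]); last first.
    apply/seteqP; split => z; rewrite /D /err /=; first by move=> ->.
    by case: (_ != _) => //= /eqP; rewrite eq_sym oner_eq0.
  rewrite -[X in measurable X]setTI.
  have [me _] := bm_pair1 bm_err theta.
  exact: (me measurableT [set 1]).
pose A j := if j == i then D else setT.
have := product_probabilityE P (A := A).
rewrite (_ : [set w : Omega | forall j, A j (tnth w j)] =
    [set w : Omega | f theta (tnth w i).1 != (tnth w i).2]); last first.
  apply/seteqP; split => w /= Aw; first by have := Aw i; rewrite /A eqxx.
  by move=> j; rewrite /A; case: eqP => // ->.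
move=> ->; last by move=> j; rewrite /A; case: ifP.
rewrite (bigD1 i)//= big1 ?mule1; last first.
  by move=> j /negbTE ji; rewrite /A ji probability_setT.
rewrite /A eqxx /coord_risk /Rintegral; congr fine.
under eq_integral do rewrite errE.
by rewrite integral_indic// setIT.
Qed.

Lemma coord_risk01 i theta : 0 <= coord_risk i theta <= 1.
Proof.
have be := bm_pair1 bm_err theta.
apply/andP; split.
- by apply: bm_Rintegral_ge => // z; have /andP[] := err01 theta z.
- by apply: bm_Rintegral_le => // z; have /andP[] := err01 theta z.
Qed.

Let N0 : 0 < N%:R :> R. Proof. by rewrite ltr0n. Qed.

Lemma mean01 (a : 'I_N -> R) : (forall i, 0 <= a i <= 1) ->
  0 <= N%:R^-1 * \sum_(i < N) a i <= 1.
Proof.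
move=> a01; apply/andP; split.
  rewrite mulr_ge0 ?invr_ge0// sumr_ge0// => i _.
  by have /andP[] := a01 i.
rewrite ler_pdivrMl// mulr1 -[leRHS]mulr1 -[N in leRHS]card_ord.
rewrite mulr_natl -sumr_const ler_sum// => i _.
by have /andP[] := a01 i.
Qed.

Lemma risk01 theta : 0 <= risk P f theta <= 1.
Proof. by rewrite riskE; apply: mean01 => i; exact: coord_risk01. Qed.

Lemma bm_risk : bounded_measurable (risk P f).
Proof.
rewrite (_ : risk P f = fun x => N%:R^-1 * \sum_(i < N) coord_risk i x).
  by apply/bmZ/bm_sum => i; exact: (bm_Rintegral2 (P i) bm_err).
by apply/funext => x; exact: riskE.
Qed.

Lemma bm_err_tnth d (T : measurableType d) i (w : T -> Omega) (x : T -> Theta) :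
  measurable_fun setT w -> measurable_fun setT x ->
  bounded_measurable (fun p => err f (x p) (tnth (w p) i) : R).
Proof.
move=> mw mx.
apply: (bm_comp bm_err (g := fun p => (x p, tnth (w p) i))).
apply: measurable_fun_pair => //.
by apply: (@measurableT_comp _ _ _ _ _ _ (fun v : Omega => tnth v i)) => //;
  exact: measurable_tnth.
Qed.

Lemma bm_emp_risk_comp d (T : measurableType d) (w : T -> Omega) (x : T -> Theta) :
  measurable_fun setT w -> measurable_fun setT x ->
  bounded_measurable (fun p => emp_risk f (w p) (x p) : R).
Proof.
move=> mw mx; apply: bmZ.
by apply: (bm_sum _ (h := fun i p => err f (x p) (tnth (w p) i))) => i;
  exact: bm_err_tnth.
Qed.

Lemma bm_emp_risk (w : Omega) : bounded_measurable (emp_risk f w : Theta -> R).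
Proof. exact: (@bm_emp_risk_comp _ _ (cst w) id). Qed.

Lemma bm_emp_dist_comp d (T : measurableType d) (w : T -> Omega)
    (x y : T -> Theta) :
  measurable_fun setT w -> measurable_fun setT x -> measurable_fun setT y ->
  bounded_measurable (fun p => emp_dist f (w p) (x p) (y p) : R).
Proof.
move=> mw mx my; apply: bmZ.
apply: (bm_sum _ (h := fun i p =>
  `|err f (x p) (tnth (w p) i) - err f (y p) (tnth (w p) i)|)) => i.
by apply/bm_norm/bmB; exact: bm_err_tnth.
Qed.

Lemma bm_emp_dist (w : Omega) :
  bounded_measurable (fun p : Theta * Theta => emp_dist f w p.1 p.2 : R).
Proof. exact: (@bm_emp_dist_comp _ _ (cst w) fst snd). Qed.

Lemma emp_dist_sym (w : Omega) x y : emp_dist f w x y = emp_dist f w y x :> R.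
Proof. by congr (_ * _); apply: eq_bigr => i _; rewrite distrC. Qed.

Lemma emp_dist_ge0 (w : Omega) x y : 0 <= emp_dist f w x y :> R.
Proof. by rewrite mulr_ge0 ?invr_ge0// sumr_ge0. Qed.

Lemma emp_dist_triangle (w : Omega) x y z :
  emp_dist f w x z <= emp_dist f w x y + emp_dist f w y z :> R.
Proof.
rewrite -mulrDr ler_wpM2l ?invr_ge0// -big_split ler_sum//= => i _.
exact: ler_distD.
Qed.

Lemma Rintegral_product_probability (g : 'I_N -> X * Y -> R) :
  (forall i, bounded_measurable (g i)) -> (forall i z, 0 <= g i z) ->
  \int[PP]_w (\prod_(i < N) g i (tnth w i)) = \prod_(i < N) \int[P i]_z g i z.
Proof.
move=> bg g0; rewrite {1}/Rintegral integral_product_probability//; last first.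
  by move=> i; case: (bg i).
under eq_bigr do rewrite -bm_EFin_Rintegral//.
by rewrite prodEFin.
Qed.

Section deviation_bound.
Variable gamma : R.
Hypothesis gamma_gt0 : 0 < gamma.

Local Notation t := (tanh (gamma / N%:R)).
Local Notation Dev w := (deviation N (emp_risk f w) (risk P f) (emp_dist f w) gamma).

Let t_gt0 : 0 < t. Proof. by rewrite tanh_gt0// divr_gt0. Qed.
Let t_lt1 : t < 1. Proof. exact: tanh_lt1. Qed.

Lemma expR_deviation (w : Omega) x y : expR (Dev w x y) =
  expR (F N gamma 0 (risk P f x - risk P f y)) *
  \prod_(i < N) (1 - t * (err f x (tnth w i) - err f y (tnth w i))).
Proof.
rewrite /deviation -addrA expRD; congr (_ * _).
have errP i : let psi := err f x (tnth w i) - err f y (tnth w i) : R in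
    psi = -1 \/ psi = 0 \/ psi = 1.
  rewrite /err; case: (_ != _); case: (_ != _) => /=; rewrite ?subrr ?subr0 ?sub0r; tauto.
under eq_bigr do rewrite -expR_lin_cosh//.
rewrite -expR_sum; congr expR.
rewrite sumrB sumrN -!mulr_sumr /emp_risk /emp_dist -mulrBr -sumrB.
congr (- _ - _); first by rewrite mulrA.
by rewrite mulrACA mulfV ?mul1r// gt_eqF.
Qed.

(** The inequality of arithmetic and geometric means; equality holds when the
    examples are identically distributed. *)
Lemma prod_le_expRN_F x y :
  \prod_(i < N) (1 - t * (coord_risk i x - coord_risk i y)) <=
  expR (- F N gamma 0 (risk P f x - risk P f y)).
Proof.
have c01 i : 0 <= 1 - t * (coord_risk i x - coord_risk i y).
  have /andP[x0 x1] := coord_risk01 i x; have /andP[y0 y1] := coord_risk01 i y.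
  have : t * (coord_risk i x - coord_risk i y) <= t * 1.
    by rewrite ler_wpM2l ?(ltW t_gt0)//; lra.
  by move: t_lt1; lra.
have [+ _] := @leif_AGM R 'I_N predT
  (fun i => 1 - t * (coord_risk i x - coord_risk i y)) (fun i _ => c01 i).
rewrite (eq_bigl predT)// => /le_trans; apply.
have -> : (\sum_(i in 'I_N) (1 - t * (coord_risk i x - coord_risk i y))) /
    #|'I_N|%:R = 1 - t * (risk P f x - risk P f y).
  rewrite card_ord sumrB -mulr_sumr sumrB sumr_const card_ord !riskE.
  by field; rewrite gt_eqF.
have /andP[x0 x1] := risk01 x; have /andP[y0 y1] := risk01 y.
rewrite card_ord /F mul0r subr0 mulNr opprK expRM_natl lnK// posrE.
apply: one_sub_tanhM_gt0 => //; apply: lt_tanhV => //; lra.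
Qed.

Lemma expected_deviation x y : \int[PP]_w expR (Dev w x y) <= 1.
Proof.
under eq_Rintegral do rewrite expR_deviation.
have be (z : Theta) := bm_pair1 bm_err z.
have bpsi : bounded_measurable (fun z => 1 - t * (err f x z - err f y z)).
  apply: bmB; first exact: bm_cst.
  by apply: bmZ; apply: bmB; exact: be.
have psi0 z : 0 <= 1 - t * (err f x z - err f y z).
  have /andP[x0 x1] := err01 x z; have /andP[y0 y1] := err01 y z.
  have : t * (err f x z - err f y z) <= t * 1.
    by rewrite ler_wpM2l ?(ltW t_gt0)//; lra.
  by move: t_lt1; lra.
rewrite bm_RintegralZ; last first.
  apply: (bm_prod _ (h := fun i (w : Omega) =>
    1 - t * (err f x (tnth w i) - err f y (tnth w i)))) => i.
  apply: (bm_comp bpsi (g := fun w : Omega => tnth w i)).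
  exact: measurable_tnth.
rewrite (Rintegral_product_probability
  (g := fun i z => 1 - t * (err f x z - err f y z)))//.
have -> : \prod_(i < N) \int[P i]_z (1 - t * (err f x z - err f y z)) =
    \prod_(i < N) (1 - t * (coord_risk i x - coord_risk i y)).
  apply: eq_bigr => i _.
  rewrite bm_RintegralB ?Rintegral_prob_cst; last 2 first.
  - exact: bm_cst.
  - by apply: bmZ; apply: bmB; exact: be.
  rewrite bm_RintegralZ; last by apply: bmB; exact: be.
  by rewrite bm_RintegralB; [|exact: be|exact: be].
rewrite -ler_pdivlMl ?expR_gt0// mulr1 -expRN.
exact: prod_le_expRN_F.
Qed.

Lemma bm_deviation_comp d (T : measurableType d) (w : T -> Omega)
    (x y : T -> Theta) :
  measurable_fun setT w -> measurable_fun setT x -> measurable_fun setT y ->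
  bounded_measurable (fun p => Dev (w p) (x p) (y p)).
Proof.
move=> mw mx my.
rewrite /deviation; apply: bmB; last by apply: bmZ; exact: bm_emp_dist_comp.
apply: bmB; last by apply: bmZ; apply: bmB; exact: bm_emp_risk_comp.
apply: (bm_F N_gt0 gamma_gt0 0
  (h := fun p => risk P f (x p) - risk P f (y p))).
  by apply: bmB; exact: bm_comp bm_risk _.
move=> p; have /andP[x0 x1] := risk01 (x p); have /andP[y0 y1] := risk01 (y p).
lra.
Qed.

Definition mean_deviation (mu : probability Theta R) (w : Omega) : R :=
  \int[mu]_x \int[mu]_y expR (Dev w x y).

Lemma bm_mean_deviation2 (mu : probability Theta R) : bounded_measurable
  (fun p : Omega * Theta => \int[mu]_y expR (Dev p.1 p.2 y)).
Proof.
have b3 : bounded_measurable (fun p : (Omega * Theta) * Theta =>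
    expR (Dev p.1.1 p.1.2 p.2)).
  by apply/bm_expR/bm_deviation_comp => //; exact: measurableT_comp.
exact: (bm_Rintegral2 mu b3).
Qed.

Lemma bm_mean_deviation mu : bounded_measurable (mean_deviation mu).
Proof. exact: (bm_Rintegral2 mu (bm_mean_deviation2 mu)). Qed.

Lemma mean_deviation_ge0 mu w : 0 <= mean_deviation mu w.
Proof.
by apply: Rintegral_ge0 => x _; apply: Rintegral_ge0 => y _; exact: expR_ge0.
Qed.

Lemma expected_mean_deviation mu : \int[PP]_w mean_deviation mu w <= 1.
Proof.
have b1 := bm_mean_deviation2 mu.
rewrite /mean_deviation (bm_fubini PP mu b1).
apply: bm_Rintegral_le => [|x].
  have b1' : bounded_measurable (fun p : Theta * Omega =>
      \int[mu]_y expR (Dev p.2 p.1 y)).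
    have msw : measurable_fun setT (fun p : Theta * Omega => (p.2, p.1)).
      exact: measurable_fun_pair.
    exact: (bm_comp b1 msw).
  exact: (bm_Rintegral2 PP b1').
have b2 : bounded_measurable (fun p : Omega * Theta => expR (Dev p.1 x p.2)).
  by apply/bm_expR/bm_deviation_comp.
rewrite (bm_fubini PP mu b2).
apply: bm_Rintegral_le => [|y]; last exact: expected_deviation.
have b2' : bounded_measurable (fun p : Theta * Omega => expR (Dev p.2 x p.1)).
  by apply/bm_expR/bm_deviation_comp.
exact: (bm_Rintegral2 PP b2').
Qed.

End deviation_bound.

End sample.

(** * Markov's inequality and the union bound over atoms *)

Lemma measurable_superlevel d (T : measurableType d) (R : realType) (h : T -> R)
    (c : R) : measurable_fun setT h -> measurable [set x | c < h x].
Proof.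
move=> mh; rewrite -[X in measurable X]setTI.
rewrite (_ : [set x | _] = [set x | (cst c x)%:E < (h x)%:E]%E)//.
by apply: emeasurable_fun_lt => //; exact/measurable_EFinP.
Qed.

Lemma bm_Markov d (T : measurableType d) (R : realType) (Q : probability T R)
    (h : T -> R) (c : R) :
  bounded_measurable h -> (forall x, 0 <= h x) -> \int[Q]_x h x <= 1 ->
  0 < c -> (Q [set x | c^-1 < h x]%R <= c%:E)%E.
Proof.
move=> bh h0 h1 c0; have [mh _] := bh; set A := [set x | _].
have mA : measurable A by exact: measurable_superlevel.
have bA : bounded_measurable (\1_A : T -> R).
  split; first exact: measurable_indic.
  by exists 1 => x; rewrite indicE ger0_norm//; case: (_ \in _).
have QA : \int[Q]_x \1_A x = fine (Q A).
  by rewrite /Rintegral integral_indic// setIT.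
rewrite -[leLHS]fineK ?fin_num_measure// lee_fin -QA.
rewrite -[leRHS]mulr1 -ler_pdivrMl// -bm_RintegralZ//.
apply: le_trans h1; apply: bm_le_Rintegral => //; first exact: bmZ.
move=> x; rewrite indicE; case: (boolP (x \in A)) => [|_]; rewrite ?mulr0//.
by rewrite inE mulr1 => /ltW.
Qed.

(** The pairs of atoms are enumerated through a countable set S of full measure:
    S is cut into the fibers [Sn n] of an injection into nat, each empty or a
    singleton, whose masses sum to 1. *)
Lemma atomic_union_bound d (T : measurableType d) (R : realType)
    (Q : probability T R) (nu : probability (measurableTypeR R) R)
    (Bad : R -> R -> set T) (eps : R) :
  atomic nu -> 0 <= eps -> (forall b g, measurable (Bad b g)) ->
  (forall b g, Q (Bad b g) <= eps%:E * nu [set b] * nu [set g])%E ->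
  exists E : set T, [/\ measurable E, ((1 - eps)%:E <= Q E)%E &
    forall w, E w -> forall b g, nu [set b] != 0%E -> nu [set g] != 0%E ->
      ~ Bad b g w].
Proof.
move=> [S [/countable_injP[i injS] mS S1]] eps0 mBad QBad.
pose Sn n := [set x | S x /\ i x = n].
have Sn_cases n : Sn n = set0 \/ exists x : R, Sn n = [set x].
  have [[x Snx]|Sn0] := pselect (exists x, Sn n x).
    right; exists x; apply/seteqP; split => y /=; last by move=> ->.
    move=> [Sy yn]; have [Sx xn] := Snx.
    by apply: injS; rewrite ?inE// yn xn.
  by left; rewrite -subset0 => x Snx; apply: Sn0; exists x.
have mSn n : @measurable _ (measurableTypeR R) (Sn n).
  by have [->|[x ->]] := Sn_cases n; [exact: measurable0|exact: measurable_set1].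
have SE : S = \bigcup_n Sn n.
  by apply/seteqP; split => [x Sx|x [n _ []//]]; exists (i x).
have sum_nu : (\sum_(n <oo) nu (Sn n) = 1)%E.
  rewrite -S1 [in RHS]SE; apply/esym/measure_semi_bigcup => //.
  - by apply/trivIsetP => n m _ _ /eqP nm; rewrite -subset0 => x [[_ xn] [_ xm]];
      apply: nm; rewrite -xn -xm.
  - by rewrite -SE.
pose Bnm n m := \bigcup_(b in Sn n) \bigcup_(g in Sn m) Bad b g.
have Bnm_cases n m : measurable (Bnm n m) /\
    (Q (Bnm n m) <= eps%:E * nu (Sn n) * nu (Sn m))%E.
  rewrite /Bnm; have [->|[b ->]] := Sn_cases n.
    by rewrite bigcup_set0 !measure0 mule0 mul0e; split.
  have [->|[g ->]] := Sn_cases m.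
    by rewrite bigcup_set1 bigcup_set0 !measure0 mule0; split.
  by rewrite !bigcup_set1; split; [exact: mBad|exact: QBad].
pose Bn n := \bigcup_m Bnm n m.
have mBn n : measurable (Bn n).
  by apply: bigcupT_measurable => m; have [] := Bnm_cases n m.
have QBn n : (Q (Bn n) <= eps%:E * nu (Sn n))%E.
  apply: (@le_trans _ _ (\sum_(m <oo) Q (Bnm n m))%E).
    apply: measure_sigma_subadditive => //.
    by move=> m; have [] := Bnm_cases n m.
  apply: (@le_trans _ _ (\sum_(m <oo) (eps%:E * nu (Sn n)) * nu (Sn m))%E).
    by apply: lee_nneseries => // m _; have [] := Bnm_cases n m.
  rewrite -[(nu (Sn n))]fineK ?fin_num_measure// -EFinM nneseriesZl//.
  by rewrite sum_nu mule1.
pose Bt := \bigcup_n Bn n.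
have mBt : measurable Bt by exact: bigcupT_measurable.
have QBt : (Q Bt <= eps%:E)%E.
  apply: (@le_trans _ _ (\sum_(n <oo) Q (Bn n))%E).
    exact: measure_sigma_subadditive.
  apply: (@le_trans _ _ (\sum_(n <oo) eps%:E * nu (Sn n))%E).
    by apply: lee_nneseries.
  by rewrite nneseriesZl// sum_nu mule1.
exists (~` Bt); split; first exact: measurableC.
  by rewrite probability_setC// EFinB leeB.
have inS x : nu [set x] != 0%E -> S x.
  move=> /eqP nux; apply: contrapT => nSx; apply: nux; apply/eqP.
  rewrite eq_le measure_ge0 andbT.
  have <- : (nu (~` S) = 0)%E by rewrite probability_setC// S1 subee.
  apply: le_measure; rewrite ?inE//; first exact: measurableC.
  by move=> y -> /=.
move=> w Btw b g /inS Sb /inS Sg Bbg; apply: Btw.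
by exists (i b) => //; exists (i g) => //; exists b => //; exists g.
Qed.

(** * The bound and its explicit form *)

Section confidence_level.
Context (R : realType) (eps : R) (nu : probability (measurableTypeR R) R).
Hypothesis eps01 : 0 < eps < 1.
Implicit Types beta gamma : R.

Lemma atom_ge0_le1 (b : R) : 0 <= fine (nu [set b]) <= 1.
Proof.
rewrite fine_ge0//= -lee_fin fineK ?fin_num_measure//.
exact: probability_le1.
Qed.

Lemma atom_gt0 (b : R) : nu [set b] != 0%E -> 0 < fine (nu [set b]).
Proof.
move=> b0; rewrite fine_gt0// lt0e b0 measure_ge0/=.
by rewrite -ge0_fin_numE ?fin_num_measure.
Qed.

Lemma log_level_le0 beta gamma : log_level eps nu beta gamma <= 0.
Proof.
have /andP[e0 e1] := eps01.
have /andP[b0 b1] := atom_ge0_le1 beta; have /andP[g0 g1] := atom_ge0_le1 gamma.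
by apply: ln_le0; rewrite mulr_ile1 ?mulr_ge0 ?mulr_ile1// ltW.
Qed.

Lemma expRN_log_level beta gamma :
  nu [set beta] != 0%E -> nu [set gamma] != 0%E ->
  expR (- log_level eps nu beta gamma) =
  (eps * fine (nu [set beta]) * fine (nu [set gamma]))^-1.
Proof.
move=> b0 g0; have /andP[e0 _] := eps01.
by rewrite expRN lnK// posrE !mulr_gt0// atom_gt0.
Qed.

End confidence_level.

Section bounds.
Context (R : realType) (N : nat) (dX dY dT : measure_display)
  (X : measurableType dX) (Y : measurableType dY) (Theta : measurableType dT).
Variables (P : 'I_N -> probability (X * Y)%type R) (f : Theta -> X -> Y)
  (prior : probability Theta R) (eps : R)
  (nu : probability (measurableTypeR R) R).
Hypotheses (N_gt0 : (0 < N)%N) (finY : finite_set [set: Y])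
  (mY : forall A : set Y, measurable A)
  (mf : measurable_fun [set: (Theta * X)%type] (fun p => f p.1 p.2))
  (eps01 : 0 < eps < 1).

Local Notation Omega := (N.-tuple (X * Y)%type).
Local Notation PP := (product_probability P).
Implicit Types (w : Omega) (rho : probability Theta R) (beta gamma : R).

Lemma entropy_le_KL w rho (l k : R) : KL rho (gibbs_emp f prior w l) = k%:E ->
  entropy_le prior (emp_risk f w) rho l k.
Proof.
move=> KLk g bg; have := Donsker_Varadhan (gibbs_emp f prior w l) rho bg.
rewrite KLk -EFinD lee_fin log_partition_gibbs//.
  by rewrite addrC.
by apply/bmZ/bm_emp_risk.
Qed.

Lemma le_F_B w rho beta gamma : 0 < beta -> 0 < gamma ->
  (nu [set beta] != 0%E -> nu [set gamma] != 0%E ->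
   mean_deviation P f gamma (gibbs_risk P f prior beta) w <=
   expR (- log_level eps nu beta gamma)) ->
  ((F N gamma beta (excess_risk P f prior rho beta))%:E <=
   B f prior eps nu w rho beta gamma)%E.
Proof.
move=> beta0 gamma0 event; rewrite /B /inf_bound.
case: ifPn => [_|]; first exact: leey.
rewrite negb_or => /andP[nub nug].
apply: le_ereal_inf_tmp => _ [l1 /= l1P [l2 /= l2P <-]].
case KLE : (KL rho (gibbs_emp f prior w l1)) => [k| |].
- rewrite -EFinD lee_fin.
  have := entropy_le_KL KLE.
  apply: (relative_bound N_gt0 _ _ _ _ _ _ _ beta0 gamma0 _ (event nub nug) l1P l2P).
  + exact: bm_emp_risk.
  + exact: bm_risk.
  + exact: risk01.
  + exact: bm_emp_dist.
  + exact: emp_dist_sym.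
  + exact: emp_dist_ge0.
  + exact: emp_dist_triangle.
  + by rewrite oppr_ge0; exact: log_level_le0.
- by rewrite addye// leey.
- have := Donsker_Varadhan (gibbs_emp f prior w l1) rho (@bm_cst _ Theta R 0).
  by rewrite KLE addNye leeNy_eq.
Qed.

(** Term by term: F_inv is replaced by the linear bound of [F_inv_le], and the
    slope N tanh (gamma / N) - beta gamma / l2 is gamma times the denominator of
    the explicit coefficient. *)
Lemma B_le_B_explicit w rho beta gamma : 0 < beta -> 0 < gamma ->
  (B f prior eps nu w rho beta gamma <=
   B_explicit f prior eps nu w rho beta gamma)%E.
Proof.
move=> beta0 gamma0; rewrite /B /B_explicit /inf_bound; case: ifP => // _.
apply: le_ereal_inf_tmp => _ [l1 /= /andP[l10 l1g] [l2 /= l2P <-]].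
apply: (@le_trans _ _ _ _ _ (ereal_inf_lbound _)).
  by exists l1 => //=; [rewrite l10|exists l2].
rewrite leeD2l// lee_fin.
set r1 := (gamma - l1) * (_ - _); set L1 := log_exp_dist _ _ _ _ _ _.
set L2 := log_exp_dist _ _ _ _ _ _; set lev := log_level _ _ _ _.
have lev0 : lev <= 0 by exact: log_level_le0.
have L20 : 0 <= L2.
  by apply: ln_exp_dist_ge0;
    [exact: bm_emp_dist|exact: emp_dist_sym|exact: emp_dist_ge0].
have y0 : 0 <= L2 - lev by rewrite subr_ge0 (le_trans lev0).
have N0 : 0 < N%:R :> R by rewrite ltr0n.
have t0 : 0 < tanh (gamma / N%:R) by rewrite tanh_gt0// divr_gt0.
have l20 : 0 < l2 by apply: lt_trans l2P; rewrite !mulr_gt0 ?invr_gt0.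
have slope : beta * gamma / l2 < N%:R * tanh (gamma / N%:R) by exact: slope_lt.
have := F_inv_le N_gt0 gamma0 slope y0.
set xh := F_inv _ _ _ _; set s := N%:R * _ - _; move=> xh_le.
have s0 : 0 < s by rewrite subr_gt0.
set c := beta / l2 * _.
have cE : (gamma - l1) * (beta / l2) * ((L2 - lev) / s) = c * (L2 - lev).
  have -> : c = beta / l2 * ((gamma - l1) / s).
    congr (_ * _).
    have -> : 1 - l1 / gamma = (gamma - l1) / gamma by field; rewrite gt_eqF.
    have -> : N%:R / gamma * tanh (gamma / N%:R) - beta / l2 = s / gamma.
      by rewrite /s; field; rewrite !gt_eqF.
    by field; rewrite !gt_eqF.
  by field; rewrite !gt_eqF.
have : (gamma - l1) * (beta / l2) * xh <= c * (L2 - lev).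
  by rewrite -cE ler_wpM2l// mulr_ge0 ?subr_ge0// divr_ge0// ltW.
lra.
Qed.

Lemma likely_deviation_event : atomic nu ->
  exists E : set Omega, [/\ measurable E, ((1 - eps)%:E <= PP E)%E &
    forall w, E w -> forall beta gamma, 0 < beta -> 0 < gamma ->
      nu [set beta] != 0%E -> nu [set gamma] != 0%E ->
      mean_deviation P f gamma (gibbs_risk P f prior beta) w <=
      expR (- log_level eps nu beta gamma)].
Proof.
move=> atomic_nu.
pose ok (b g : R) := [&& 0 < b, 0 < g, nu [set b] != 0%E & nu [set g] != 0%E].
pose Bad (b g : R) : set Omega := if ok b g then
  [set w | (eps * fine (nu [set b]) * fine (nu [set g]))^-1 <
    mean_deviation P f g (gibbs_risk P f prior b) w] else set0.
have /andP[eps0 _] := eps01.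
have [b g|b g|E [mE PE EBad]] :=
  @atomic_union_bound _ _ _ PP nu Bad eps atomic_nu (ltW eps0).
- rewrite /Bad; case: ifPn => // /and4P[b0 g0 nub nug].
  have [mD _] := bm_mean_deviation P N_gt0 finY mY mf g0 (gibbs_risk P f prior b).
  exact: measurable_superlevel.
- rewrite /Bad; case: ifPn => [/and4P[b0 g0 nub nug]|_]; last first.
    by rewrite measure0 !mule_ge0// lee_fin ltW.
  rewrite -[nu [set b]]fineK ?fin_num_measure//.
  rewrite -[nu [set g]]fineK ?fin_num_measure// -!EFinM.
  apply: bm_Markov.
  + exact: bm_mean_deviation.
  + by move=> w; exact: mean_deviation_ge0.
  + exact: expected_mean_deviation.
  + by rewrite !mulr_gt0// atom_gt0.
exists E; split => // w Ew b g b0 g0 nub nug.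
rewrite expRN_log_level// leNgt; apply/negP => bad.
by apply: (EBad w Ew b g nub nug); rewrite /Bad /ok b0 g0 nub nug.
Qed.

End bounds.

Unset Implicit Arguments.

Theorem theorem1p39 (R : realType) (N : nat) (dX dY dT : measure_display)
    (X : measurableType dX) (Y : measurableType dY)
    (Theta : measurableType dT)
    (P : 'I_N -> probability (X * Y)%type R) (f : Theta -> X -> Y)
    (prior : probability Theta R) (eps : R)
    (nu : probability (measurableTypeR R) R) :
  (0 < N)%N ->
  countably_generated X -> countably_generated Theta ->
  finite_set [set: Y] -> (forall A : set Y, measurable A) ->
  measurable_fun [set: (Theta * X)%type] (fun p => f p.1 p.2) ->
  0 < eps < 1 ->
  atomic nu -> nu [set x : R | 0 <= x] = 1%E ->
  (exists E : set (N.-tuple (X * Y)%type),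
    [/\ measurable E, ((1 - eps)%:E <= product_probability P E)%E &
      forall w, E w ->
      forall (rho : {mfun N.-tuple (X * Y)%type >-> pprobability Theta R})
        (beta gamma : R), 0 < beta -> 0 < gamma ->
      let x := excess_risk P f prior (rho w) beta in
      (N%:R * tanh (gamma / N%:R) - beta) * x <= F N gamma beta x /\
      ((F N gamma beta x)%:E <= B f prior eps nu w (rho w) beta gamma)%E]) /\
  (forall (w : N.-tuple (X * Y)%type)
      (rho : {mfun N.-tuple (X * Y)%type >-> pprobability Theta R})
      (beta gamma : R), 0 < beta -> 0 < gamma ->
    (B f prior eps nu w (rho w) beta gamma <=
     B_explicit f prior eps nu w (rho w) beta gamma)%E).
Proof.
move=> N0 _ _ finY mY mf eps01 atomic_nu _; split; last first.
  by move=> w rho beta gamma; exact: B_le_B_explicit.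
have [E [mE PE good]] :=
  likely_deviation_event P prior N0 finY mY mf eps01 atomic_nu.
exists E; split => // w Ew rho beta gamma beta0 gamma0 x; split.
  apply: F_ge_lin => //; apply: lt_tanhV_sub => //.
    by apply: Rintegral01; [exact: bm_risk|exact: risk01].
  by apply: Rintegral01; [exact: bm_risk|exact: risk01].
by apply: le_F_B => // nub nug; exact: good.
Qed.
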